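(* Let $\mathbb{X}$ be an Asplund space, let $f:\mathbb{X}\rightarrow\mathbb{R}\cup\{+\infty\}$ be a proper lower semicontinuous function, let $\mathbf{S}_f:=\{x\in\mathbb{X}: f(x)\leq 0\}$ and let $\bar x\in\mathbf{S}_f$. Suppose that the inequality $f(x)\leq 0$ has a local error bound at $\bar x$, and set $\mathbb{B}_f(x,\epsilon):=\{u\in\mathbb{B}(x,\epsilon):|f(u)-f(x)|<\epsilon\}$. Then there exist $\tau,\delta_0>0$ such that for any $\epsilon>0$ the inclusion $$\hat N(\mathbf{S}_f,x)\cap\mathbb{B}_{\mathbb{X}^*}\subseteq\bigcup\left\{[0,(1+\epsilon)\tau]\,\hat\partial f(u)+\hat\partial^{\infty}f(v): u,v\in\mathbb{B}_f(x,\epsilon)\right\}+\epsilon\,\mathbb{B}_{\mathbb{X}^*}$$ holds for all $x\in\mathbf{S}_f\cap\mathbb{B}(\bar x,\delta_0)$.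
   Context: A Banach space $\mathbb{X}$ is an Asplund space if every continuous convex real-valued function on a nonempty open convex set $D\subseteq\mathbb{X}$ is Fréchet differentiable at each point of some dense $G_\delta$ subset of $D$. $\mathbb{X}^*$ is the dual space, $\mathbb{B}_{\mathbb{X}^*}$ its closed unit ball, $\mathbb{B}(x,r)$ is the open ball with center $x$ and radius $r$, and $\mathbf{d}(x,\Omega):=\inf\{\|x-u\|:u\in\Omega\}$. Local error bound: the inequality $f(x)\leq 0$ has a local error bound at $\bar x\in\mathbf{S}_f$ if there exist $\tau,\delta\in(0,+\infty)$ such that $\mathbf{d}(x,\mathbf{S}_f)\leq\tau f_+(x)$ for all $x\in\mathbb{B}(\bar x,\delta)$, where $f_+(x):=\max\{f(x),0\}$. Fréchet normal cone: for a subset $A$ of a Banach space $\mathbb{X}$ and $a\in A$, $\hat N(A,a):=\{x^*\in\mathbb{X}^*:\limsup_{x\to a,\,x\in A}\frac{\langle x^*,x-a\rangle}{\|x-a\|}\leq 0\}$. Subdifferentials: with $\mathrm{epi}\,f:=\{(x,r)\in\mathbb{X}\times\mathbb{R}: f(x)\leq r\}$ and $x$ with $f(x)<+\infty$, the Fréchet subdifferential is $\hat\partial f(x):=\{x^*\in\mathbb{X}^*:(x^*,-1)\in\hat N(\mathrm{epi}\,f,(x,f(x)))\}$ and the Fréchet singular subdifferential is $\hat\partial^{\infty}f(x):=\{x^*\in\mathbb{X}^*:(x^*,0)\in\hat N(\mathrm{epi}\,f,(x,f(x)))\}$. *)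

(* Defs.v *)
From HB Require Import structures.
From mathcomp Require Import all_boot all_order all_algebra.
From mathcomp Require Import all_classical all_reals all_analysis.
From mathcomp Require Import borel_hierarchy.

Set Implicit Arguments.
Unset Strict Implicit.
Unset Printing Implicit Defensive.

Import Order.TTheory GRing.Theory Num.Theory.
Import numFieldNormedType.Exports.

Local Open Scope classical_set_scope.
Local Open Scope ring_scope.

Section minkowski.
Context {R : numDomainType} {V : lmodType R}.

Definition set_add (A B : set V) : set V := [set a + b | a in A & b in B].

Definition set_scale (T : set R) (A : set V) : set V :=
  [set t *: a | t in T & a in A].

End minkowski.

Section dual.
Context {R : realType} (X : normedModType R).

(* The dual is a set in the lmodType of all functions X -> R^o, whose pointwise
   operations are the ones used for sums and multiples of functionals. *)
Definition cont_dual : set (X -> R^o) := [set phi | linear phi /\ continuous phi].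

Definition dual_norm (phi : X -> R^o) : R :=
  sup [set `|phi x| | x in [set x : X | `|x| <= 1]].

Definition dual_unit_ball : set (X -> R^o) :=
  [set phi | cont_dual phi /\ dual_norm phi <= 1].

End dual.
Arguments dual_unit_ball {R} X.

Section asplund.
Context {R : realType}.

(* A function on D is represented by a total g of which only the values on D
   matter: D is open, so differentiability at a point of D is local to D.
   Likewise, being a G_delta of X or of the open subspace D is the same. *)
Definition asplund_space (X : completeNormedModType R) : Prop :=
  forall (D : set X) (g : X -> R^o),
    open D -> D !=set0 -> convex_set D ->
    convex_function D g -> {within D, continuous g} ->
    exists E : set X,
      [/\ Gdelta E, E `<=` D, D `<=` closure E &
          forall x, E x -> differentiable g x].

End asplund.

Section variational.
Context {R : realType} {X : normedModType R}.
Local Open Scope ereal_scope.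

(* The filter within A a^' is x -> a with x in A and x != a; if a is isolated
   in A, the upper limit is -oo and every functional is a normal. *)
Definition frechet_normal_cone (A : set X) (a : X) : set (X -> R^o) :=
  [set phi | cont_dual phi /\
    limf_esup (fun x => (phi (x - a) / `|x - a|)%R%:E) (within A a^') <= 0].

Definition proper_fun (f : X -> \bar R) : Prop :=
  (forall x, -oo < f x) /\ exists x, f x < +oo.

Definition sublevel0 (f : X -> \bar R) : set X := [set x | f x <= 0].

Definition dist_set (x : X) (A : set X) : \bar R :=
  ereal_inf [set (`|x - u|%R)%:E | u in A].

Definition local_error_bound (f : X -> \bar R) (xbar : X) : Prop :=
  exists tau delta : R, [/\ (0 < tau)%R, (0 < delta)%R &
    forall x, ball xbar delta x ->
      dist_set x (sublevel0 f) <= tau%:E * maxe (f x) 0].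

Definition fball (f : X -> \bar R) (x : X) (eps : R) : set X :=
  [set u | ball x eps u /\ `|f u - f x| < eps%:E].

End variational.

Section subdifferentials.
Context {R : realType} {X : normedModType R}.

Definition epi (f : X -> \bar R) : set (X * R^o) :=
  [set z | (f z.1 <= z.2%:E)%E].

(* The functional (phi, alpha) on X * R, with <(phi, alpha), (x, r)> equal to
   <phi, x> + alpha r. *)
Definition dual_pair (phi : X -> R^o) (alpha : R) : X * R^o -> R^o :=
  fun z => phi z.1 + alpha * z.2.

Definition frechet_subdiff (f : X -> \bar R) (x : X) : set (X -> R^o) :=
  [set phi | (f x < +oo)%E /\ cont_dual phi /\
    frechet_normal_cone (epi f) (x, fine (f x)) (dual_pair phi (-1))].

Definition frechet_singular_subdiff (f : X -> \bar R) (x : X) :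
    set (X -> R^o) :=
  [set phi | (f x < +oo)%E /\ cont_dual phi /\
    frechet_normal_cone (epi f) (x, fine (f x)) (dual_pair phi 0)].

End subdifferentials.

(* Main.v *)
(* The singular term can be taken to be 0. For x in S_f, a normal x* of norm at
   most 1 satisfies <x*, u - x> <= d(u, S_f) + o(u - x), hence by the error bound
   <x*, u - x> <= tau (f u - f x)^+ + o(u - x). After smoothing the positive part
   to an increasing C^1 function phi, the function tau phi(f - f x) - x* is almost
   minimal at x, and a small Frechet subgradient of it at a nearby point u exhibits
   x* as a multiple of a Frechet subgradient of f at u, up to epsilon.

   Existence of such small subgradients in an Asplund space X goes by separable
   reduction. By Hahn-Banach, having a Frechet subgradient with a prescribed
   modulus is a condition on finite convex combinations, so there is a separable
   closed subspace Y such that subgradients of the restriction to Y come with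
   subgradients on X. The dual of Y is separable (in the form: the dual ball of X
   has a countable subset dense for uniform convergence on the ball of Y), since
   otherwise some continuous sublinear function on X would be nowhere Frechet
   differentiable. Hence there is a Lipschitz convex function on Y that is Frechet
   smooth and behaves like a norm at infinity, and Borwein and Preiss' variational
   principle applies on Y. *)
Require Import Defs.
From mathcomp Require Import all_boot all_order all_algebra.
From mathcomp Require Import all_classical all_reals all_analysis.
From mathcomp Require Import ring lra.

Import Order.TTheory GRing.Theory Num.Theory.
Import numFieldNormedType.Exports.

Local Open Scope classical_set_scope.
Local Open Scope ring_scope.


(** * Series with weights [2^-(n+1)] *)

(** The Asplund property speaks of functions on the whole space, while a rough set of functionals is
    only seen on [Y]. A minimal sublinear function on the whole space dominating its support
    function on [Y] bridges the two: by minimality, every cut of it is detected at some point of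
    [Y]. The smooth function on [Y] is a conjugate: the supremum over the dual ball of
    [p y - s * Q p]. By Smulian's criterion it is smooth once near-maximizers converge uniformly on
    the ball of [Y]. To this end [Q] sums squares of two kinds: values on a dense sequence, which
    give pointwise convergence, and seminorms that tend to 0 at each fixed functional, which make it
    uniform. Infinite values of [f] are avoided by capping it at [f x + 1]. The capped function is
    only lower semicontinuous, so the chain rule for the positive part has to survive upward jumps;
    a smoothing with a quadratic upper estimate allows this, and its strictly positive derivative
    permits dividing by the multiplier. *)

Section weighted_sum.
Context {R : realType}.
Implicit Types (a b : nat -> R) (M C e : R).

Definition bounded_seq a := exists M, forall n, `|a n| <= M.

(** The weights have sum 1, so that averages of functionals in the dual ball stay in it. *)
Definition wsum a : R := limn (series (fun n => 2^-1 ^+ n.+1 * a n) : R^o^nat).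

Lemma sum_half_expr N : \sum_(0 <= n < N) (2^-1 ^+ n.+1 : R) = 1 - 2^-1 ^+ N.
Proof.
elim: N => [|N IH]; first by rewrite big_nil expr0 subrr.
by rewrite big_nat_recr//= IH [in LHS]exprS [in RHS]exprS; lra.
Qed.

Lemma half_expr_gt0 n : 0 < (2^-1 : R) ^+ n.
Proof. by rewrite exprn_gt0. Qed.

Lemma half_expr_lt e : 0 < e -> exists N, (2^-1 : R) ^+ N < e.
Proof.
move=> e0.
have h : `|2^-1 : R| < 1 by rewrite ger0_norm//; lra.
have /cvgrPdist_lt /(_ _ e0) [N _ HN] := @cvg_geometric R 1 _ h.
exists N; have /= := HN N (leqnn N).
by rewrite mul1r sub0r normrN ger0_norm// ltW// half_expr_gt0.
Qed.

Lemma wsum_cvg a : bounded_seq a ->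
  cvgn (series (fun n => 2^-1 ^+ n.+1 * a n) : R^o^nat).
Proof.
move=> [M aM]; apply: (@normed_cvg R R^o).
apply: (@series_le_cvg _ _ (fun n => 2^-1 ^+ n.+1 * M)) => [n|n|n|].
- exact: normr_ge0.
- by rewrite mulr_ge0// ?(le_trans _ (aM n))// ltW// half_expr_gt0.
- rewrite [leLHS](_ : _ = `|2^-1 ^+ n.+1 * a n|)// normrM ger0_norm ?(ltW (half_expr_gt0 _))//.
  by rewrite ler_wpM2l// ltW// half_expr_gt0.
- have -> : series (fun n => 2^-1 ^+ n.+1 * M) = series (geometric (M / 2) 2^-1).
    apply/funext => n; apply: eq_bigr => i _ /=.
    by rewrite exprS mulrAC [_ * M]mulrC.
  by apply: is_cvg_geometric_series; rewrite ger0_norm//; lra.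
Qed.

Lemma bounded_seqD a b : bounded_seq a -> bounded_seq b ->
  bounded_seq (fun n => a n + b n).
Proof.
by move=> [M aM] [N bN]; exists (M + N) => n; rewrite (le_trans (ler_normD _ _))// lerD.
Qed.

Lemma bounded_seqZ c a : bounded_seq a -> bounded_seq (fun n => c * a n).
Proof.
by move=> [M aM]; exists (`|c| * M) => n; rewrite normrM ler_wpM2l.
Qed.

Lemma wsumD a b : bounded_seq a -> bounded_seq b ->
  wsum (fun n => a n + b n) = wsum a + wsum b.
Proof.
move=> ba bb; rewrite /wsum -lim_seriesD; try exact: wsum_cvg.
congr (limn (series _)); apply/funext => n /=.
by rewrite -mulrDr.
Qed.

Lemma wsumZ c a : bounded_seq a -> wsum (fun n => c * a n) = c * wsum a.
Proof.
move=> ba; rewrite /wsum.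
rewrite -[RHS](lim_seriesZ c (wsum_cvg a ba)).
congr (limn (series _)); apply/funext => n /=.
by rewrite mulrCA.
Qed.

Lemma wsum_le a b : bounded_seq a -> bounded_seq b ->
  (forall n, a n <= b n) -> wsum a <= wsum b.
Proof.
move=> ba bb ab; apply: lim_series_le; try exact: wsum_cvg.
by move=> n; rewrite ler_wpM2l// ltW// half_expr_gt0.
Qed.

Lemma wsum_partial_le a C N : bounded_seq a ->
  (forall k, (N <= k)%N -> \sum_(0 <= n < k) 2^-1 ^+ n.+1 * a n <= C) ->
  wsum a <= C.
Proof.
move=> ba aC; apply: limr_le; first exact: wsum_cvg.
by exists N => // M /= NM; exact: aC.
Qed.

Lemma wsum_cst C : wsum (fun=> C) = C.
Proof.
have b1 D : bounded_seq (fun=> D : R) by exists `|D|.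
have H (D : R) : 0 <= D -> wsum (fun=> D) <= D.
  move=> D0; apply: (@wsum_partial_le _ _ 0%N) => // k _.
  rewrite -mulr_suml sum_half_expr ler_piMl// gerBl ltW// half_expr_gt0//.
suff H1 : 1 <= wsum (fun=> 1).
  have E : (fun=> C) = (fun n : nat => C * 1) by apply/funext => n; rewrite mulr1.
  rewrite E wsumZ//; suff -> : wsum (fun=> 1) = 1 by rewrite mulr1.
  by apply/eqP; rewrite eq_le H1 H.
apply/ler_addgt0Pr => e e0; have [N HN] := half_expr_lt _ e0.
rewrite -lerBlDr; apply: limr_ge; first exact: wsum_cvg.
exists N => // M /= NM; rewrite /series/=.
have -> : \sum_(0 <= k < M) 2^-1 ^+ k.+1 * 1 = 1 - (2^-1 : R) ^+ M.
  by rewrite -sum_half_expr; apply: eq_bigr => i _; rewrite mulr1.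
rewrite lerB// (le_trans _ (ltW HN))// ler_wiXn2l//; lra.
Qed.

Lemma wsum_norm_le a C : (forall n, `|a n| <= C) -> `|wsum a| <= C.
Proof.
move=> aC; have ba : bounded_seq a by exists C.
have bc D : bounded_seq (fun=> D : R) by exists `|D|.
rewrite ler_norml -[X in X <= _ <= _]wsum_cst -[X in _ <= _ <= X]wsum_cst.
by apply/andP; split; apply: wsum_le => // n; have := aC n; rewrite ler_norml => /andP[].
Qed.

Lemma wsum_ge0 a : bounded_seq a -> (forall n, 0 <= a n) -> 0 <= wsum a.
Proof.
move=> ba a0; rewrite -(wsum_cst 0); apply: wsum_le => //.
by exists 0 => n; rewrite normr0.
Qed.

Lemma wsum_ge_partial a N : bounded_seq a -> (forall n, (N <= n)%N -> 0 <= a n) ->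
  \sum_(0 <= n < N) 2^-1 ^+ n.+1 * a n <= wsum a.
Proof.
move=> ba a0; apply: limr_ge; first exact: wsum_cvg.
exists N => // M /= NM; rewrite /series/= (big_cat_nat (leq0n N) NM)//= lerDl.
rewrite big_nat; apply: sumr_ge0 => i /andP[Ni _].
by rewrite mulr_ge0 ?a0// ltW// half_expr_gt0.
Qed.

Lemma wsum_ge_term a n : bounded_seq a -> (forall n, 0 <= a n) ->
  2^-1 ^+ n.+1 * a n <= wsum a.
Proof.
move=> ba a0; apply: (le_trans _ (wsum_ge_partial a n.+1 ba _)) => //.
rewrite big_nat_recr//= lerDr; apply: sumr_ge0 => i _.
by rewrite mulr_ge0// ltW// half_expr_gt0.
Qed.

(** The weights from index [N] on add up to at most [2^-N], so the crude bound [C] suffices there.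
    As [N] depends on [C] and [e] alone, this serves both for lower semicontinuity and for termwise
    differentiation of weighted sums. *)
Lemma wsum_le_eps C e : 0 <= C -> 0 < e -> exists N, forall a b,
  bounded_seq a -> bounded_seq b -> (forall n, a n <= b n + C) ->
  (forall n, (n < N)%N -> a n <= b n + e) -> wsum a <= wsum b + 2 * e.
Proof.
move=> C0 e0; have [N HN] := half_expr_lt (e / (C + 1)) (divr_gt0 e0 (ltr_wpDl C0 ltr01)).
exists N => a b ba bb abC abe.
have bb' : bounded_seq (fun n => -1 * b n) by exact: bounded_seqZ.
rewrite -lerBlDl -[- wsum b]mulN1r -wsumZ// -wsumD//.
apply: (@wsum_partial_le _ _ N) => [|k NM]; first exact: bounded_seqD.
rewrite (big_cat_nat (leq0n N) NM)//=.
have -> : 2 * e = e + e by lra.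
apply: lerD.
  apply: (@le_trans _ _ (\sum_(0 <= n < N) 2^-1 ^+ n.+1 * e)).
    rewrite !big_nat; apply: ler_sum => n /= nN; rewrite ler_wpM2l ?(ltW (half_expr_gt0 _))//.
    by have := abe n nN; lra.
  rewrite -mulr_suml sum_half_expr ler_piMl//; first exact: ltW.
apply: (@le_trans _ _ (\sum_(N <= n < k) 2^-1 ^+ n.+1 * C)).
  apply: ler_sum => n _; rewrite ler_wpM2l ?(ltW (half_expr_gt0 _))//.
  by have := abC n; lra.
have -> : \sum_(N <= n < k) 2^-1 ^+ n.+1 * C = (2^-1 ^+ N - 2^-1 ^+ k) * C.
  rewrite -mulr_suml; congr (_ * _).
  have := sum_half_expr k; rewrite (big_cat_nat (leq0n N) NM)//= sum_half_expr; lra.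
move: HN; rewrite ltr_pdivlMr; last by lra.
have := half_expr_gt0 k; have := half_expr_gt0 N; nra.
Qed.

End weighted_sum.


(** * Sublinear functions *)

Section sublinear.
Context {R : realType} {X : lmodType R}.
Implicit Types (p q s l : X -> R) (Y : set X).

Definition linear_form l := forall (a : R) x y, l (a *: x + y) = a * l x + l y.

Definition sublinear q :=
  (forall x y, q (x + y) <= q x + q y) /\
  (forall (t : R) x, 0 < t -> q (t *: x) = t * q x).

Lemma sublinear0 q : sublinear q -> q 0 = 0.
Proof. by case=> _ qZ; have := qZ 2 0 (ltr0n _ 2); rewrite scaler0; lra. Qed.

Lemma sublinearZ q (t : R) x : sublinear q -> 0 <= t -> q (t *: x) = t * q x.
Proof.
move=> sq; rewrite le_eqVlt => /predU1P[<-|t0]; last exact: sq.2.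
by rewrite scale0r mul0r sublinear0.
Qed.

Lemma sublinear_opp q x : sublinear q -> - q (- x) <= q x.
Proof.
by move=> sq; have := sq.1 x (- x); rewrite subrr (sublinear0 q sq); lra.
Qed.

Lemma linear_form0 l : linear_form l -> l 0 = 0.
Proof. by move=> ll; have := ll 1 0 0; rewrite scale1r addr0; lra. Qed.

Lemma linear_formD l x y : linear_form l -> l (x + y) = l x + l y.
Proof. by move=> ll; rewrite -[x]scale1r ll mul1r scale1r. Qed.

Lemma linear_formZ l (a : R) x : linear_form l -> l (a *: x) = a * l x.
Proof. by move=> ll; rewrite -[a *: x]addr0 ll linear_form0// addr0. Qed.

Lemma linear_formN l x : linear_form l -> l (- x) = - l x.
Proof. by move=> ll; rewrite -scaleN1r linear_formZ// mulN1r. Qed.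

Lemma linear_formB l x y : linear_form l -> l (x - y) = l x - l y.
Proof. by move=> ll; rewrite linear_formD// linear_formN. Qed.

(** Zorn's lemma with pointwise infima of chains: they are bounded below by [- p (- x)], and
    subadditive because two members of a chain are comparable. An empty [Y] leads to linear forms, a
    subspace [Y] to a function that cannot be lowered while staying above [l] on [Y]. *)
Lemma minimal_sublinear p Y l : sublinear p -> (forall y, Y y -> l y <= p y) ->
  exists s, [/\ sublinear s, forall x, s x <= p x, forall y, Y y -> l y <= s y &
    forall s', sublinear s' -> (forall x, s' x <= s x) ->
      (forall y, Y y -> l y <= s' y) -> forall x, s' x = s x].
Proof.
move=> sp lp.
pose P s := [/\ sublinear s, forall x, s x <= p x & forall y, Y y -> l y <= s y].
pose T := {s | P s}.
pose le (s s' : T) := `[< forall x, sval s' x <= sval s x >].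
have [||||[s Ps] /= smin] := @Zorn T le.
- by move=> s; apply/asboolP.
- move=> a b c /asboolP ab /asboolP bc; apply/asboolP => x.
  exact: le_trans (bc x) (ab x).
- move=> [a Pa] [b Pb] /asboolP/= ab /asboolP/= ba; apply: eq_exist.
  by apply/funext => x; apply/eqP; rewrite eq_le ab ba.
- move=> A totA; have [[s0 As0]|A0] := pselect (A !=set0); last first.
    have Pp : P p by split.
    by exists (exist _ p Pp) => s As; exfalso; apply: A0; exists s.
  pose E x := [set sval s x | s in A].
  pose m x := inf (E x).
  have Elb x : has_lbound (E x).
    exists (- p (- x)) => _ [[s [ss sp' sl]] As <-] /=.
    by apply: le_trans (sublinear_opp _ _ ss); rewrite lerN2.
  have Einf x : has_inf (E x) by split => //; exists (sval s0 x), s0.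
  have mle (s : T) x : A s -> m x <= sval s x by move=> As; apply: ge_inf => //; exists s.
  have mge x (a : R) : (forall s : T, A s -> a <= sval s x) -> a <= m x.
    move=> H; apply: lb_le_inf; first by exists (sval s0 x), s0.
    by move=> _ [s As <-]; exact: H.
  have mapp x (e : R) : 0 < e -> exists2 s : T, A s & sval s x < m x + e.
    by move=> e0; have [_ [s As <-] ?] := inf_adherent e0 (Einf x); exists s.
  have Pm : P m.
    split.
    - split=> [x y|t x t0].
        apply/ler_addgt0Pr => e e0.
        have [s As sx] := mapp x (e / 2) (divr_gt0 e0 (ltr0n _ 2)).
        have [s' As' sy] := mapp y (e / 2) (divr_gt0 e0 (ltr0n _ 2)).
        have [/asboolP ss'|/asboolP ss'] := totA _ _ As As'.
          have [[sub _] _ _] := svalP s'; have := sub x y; have := ss' x.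
          by have := mle s' (x + y) As'; move: sx sy; lra.
        have [[sub _] _ _] := svalP s; have := sub x y; have := ss' y.
        by have := mle s (x + y) As; move: sx sy; lra.
      apply/eqP; rewrite eq_le; apply/andP; split.
        rewrite -ler_pdivrMl//; apply: mge => s As.
        rewrite ler_pdivrMl//; have [[_ sZ] _ _] := svalP s.
        by rewrite -sZ// mle.
      apply: mge => s As; have [[_ sZ] _ _] := svalP s.
      by rewrite sZ// ler_pM2l// mle.
    - by move=> x; have [_ sp' _] := svalP s0; exact: le_trans (mle s0 x As0) (sp' x).
    - by move=> y Yy; apply: mge => s As; have [_ _ ] := svalP s; exact.
  exists (exist _ m Pm) => s As; apply/asboolP => x /=; exact: mle.
- case: (Ps) => ss sp' sl; exists s; split => // s' ss' s's ls' x.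
  have Ps' : P s' by split => // z; exact: le_trans (s's z) (sp' z).
  have /smin/(congr1 sval)/= -> // : le (exist _ s Ps) (exist _ s' Ps').
  exact/asboolP.
Qed.

(* The support function of the half [{c | c v <= r}] of a convex set with
   support function [q]. *)
Lemma sublinear_cut q v (r : R) : sublinear q -> 0 <= q (- v) + r ->
  exists q', [/\ sublinear q', forall x, q' x <= q x, q' v <= r &
    forall x (e : R), 0 < e ->
      exists2 t : R, 0 <= t & q (x - t *: v) + t * r < q' x + e].
Proof.
move=> sq qr.
(* Infimal convolution of [q] with [t * r] on the ray [t *: v], as in the duality formula for the
   support function of an intersection. The assumption on [r] bounds it below by [- q (- x)]. *)
pose E x := [set q (x - t *: v) + t * r | t in [set t : R | 0 <= t]].
pose m x := inf (E x).
have Elb x : has_lbound (E x).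
  exists (- q (- x)) => _ [t /= t0 <-].
  have := sq.1 (x - t *: v) (- x); rewrite addrAC subrr add0r -scalerN.
  by rewrite sublinearZ//; nra.
have Einf x : has_inf (E x).
  by split => //; exists (q (x - 0 *: v) + 0 * r), 0 => //=.
have mle x (t : R) : 0 <= t -> m x <= q (x - t *: v) + t * r.
  by move=> t0; apply: ge_inf => //; exists t.
have mapp x (e : R) : 0 < e -> exists2 t : R, 0 <= t & q (x - t *: v) + t * r < m x + e.
  by move=> e0; have [_ [s As <-] ?] := inf_adherent e0 (Einf x); exists s.
have mZ (t : R) x : 0 < t -> m (t *: x) <= t * m x.
  move=> t0; apply/ler_addgt0Pr => e e0.
  have [u u0 Hu] := mapp x (e / t) (divr_gt0 e0 t0).
  apply: (le_trans (mle _ (t * u) (mulr_ge0 (ltW t0) u0))).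
  rewrite -scalerA -scalerBr sq.2// -mulrA -mulrDr.
  by move: Hu; rewrite -(ltr_pM2l t0) [ltRHS]mulrDr [t * (e / t)]mulrC divfK ?gt_eqF// => /ltW.
exists m; split.
- split=> [x y|t x t0].
    apply/ler_addgt0Pr => e e0.
    have [t t0 Ht] := mapp x (e / 2) (divr_gt0 e0 (ltr0n _ 2)).
    have [u u0 Hu] := mapp y (e / 2) (divr_gt0 e0 (ltr0n _ 2)).
    have := mle (x + y) (t + u) (addr_ge0 t0 u0).
    rewrite scalerDl opprD addrACA mulrDl => /le_trans; apply.
    by have := sq.1 (x - t *: v) (y - u *: v); lra.
  apply/eqP; rewrite eq_le mZ//=.
  have := mZ t^-1 (t *: x); rewrite invr_gt0 => /(_ t0).
  by rewrite scalerK ?gt_eqF// mulrC ler_pdivlMr// mulrC.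
- by move=> x; have := mle x 0 (lexx 0); rewrite scale0r subr0 mul0r addr0.
- by have := mle v 1 ler01; rewrite scale1r subrr mul1r (sublinear0 q sq) add0r.
- exact: mapp.
Qed.

(** Minimal sublinear functions are linear: cutting [l] at [- x] with level [- l x] gives a smaller
    one, hence [l] itself, so [l (- x) <= - l x]. A preliminary cut of [q] at [- v] forces equality
    at [v]. *)
Lemma hahn_banach_form q v : sublinear q ->
  exists l, [/\ linear_form l, forall x, l x <= q x & l v = q v].
Proof.
move=> sq.
have opp_cut s x : sublinear s -> 0 <= s (- - x) + - s x by move=> _; rewrite opprK subrr.
have [q1 [sq1 q1q q1v _]] := sublinear_cut q (- v) (- q v) sq (opp_cut q v sq).
have [l [sl lq1 _ lmin]] := minimal_sublinear q1 set0 q1 sq1 (fun y (H : set0 y) => match H with end).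
have lN x : l (- x) = - l x.
  apply/eqP; rewrite eq_le; apply/andP; split.
    have [q2 [sq2 q2l q2x _]] := sublinear_cut l (- x) (- l x) sl (opp_cut l x sl).
    by rewrite -(lmin q2).
  by have := sublinear_opp l (- x) sl; rewrite opprK.
have lD x y : l (x + y) = l x + l y.
  apply/eqP; rewrite eq_le sl.1/=.
  by have := sl.1 (- x) (- y); rewrite -opprD !lN; lra.
exists l; split.
- move=> a x y; rewrite lD; congr (_ + _).
  have [a0|a0] := leP 0 a; first by rewrite sublinearZ.
  rewrite -[a *: x]opprK lN -scaleNr sublinearZ// ?oppr_ge0 ?ltW//.
  by rewrite mulNr opprK.
- by move=> x; exact: le_trans (lq1 x) (q1q x).
- apply/eqP; rewrite eq_le (le_trans (lq1 v) (q1q v))/=.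
  by have := le_trans (lq1 (- v)) q1v; rewrite lN lerN2.
Qed.

End sublinear.

Section dual_ball.
Context {R : realType} {X : normedModType R}.
Implicit Types (p : X -> R).

(** The dual unit ball without a supremum; [dual_unit_ballE] and [contractive_dual_unit_ball]
    translate. *)
Definition contractive_form p := linear_form p /\ forall x, `|p x| <= `|x|.

Lemma sublinear_norm : sublinear (fun x : X => `|x|).
Proof.
by split=> [x y|t x t0]; [exact: ler_normD|rewrite normrZ gtr0_norm].
Qed.

Lemma form_le_norm p (c : R) : linear_form p -> (forall x, p x <= c * `|x|) ->
  forall x, `|p x| <= c * `|x|.
Proof.
move=> lp pc x; rewrite ler_norml pc andbT.
by have := pc (- x); rewrite linear_formN// normrN; lra.
Qed.

Lemma norming_form (y : X) : exists2 p, contractive_form p & p y = `|y|.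
Proof.
have [l [ll lle lv]] := hahn_banach_form _ y sublinear_norm.
exists l => //; split => // x; rewrite -[leRHS]mul1r; apply: form_le_norm => // z.
by rewrite mul1r.
Qed.

End dual_ball.


(** * Separable subspaces of Asplund spaces *)

Section asplund_sublinear.
Context {R : realType} {X : completeNormedModType R}.

(** In the symmetric second difference the derivative cancels, so differentiability can be refuted
    without knowing it. Domination by the norm makes [q] 1-Lipschitz. *)
Lemma sublinear_frechet (q : X -> R) : asplund_space X -> sublinear q ->
  (forall x, q x <= `|x|) ->
  exists x0, forall e : R, 0 < e -> exists2 t : R, 0 < t & forall z, `|z| <= 1 ->
    q (x0 + t *: z) + q (x0 - t *: z) <= 2 * q x0 + e * t.
Proof.
move=> XA sq q1.
have qlip x y : `|q x - q y| <= `|x - y|.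
  rewrite ler_norml; apply/andP; split.
    have := sq.1 x (y - x); rewrite addrC subrK => h.
    by have := q1 (y - x); rewrite distrC; lra.
  have := sq.1 y (x - y); rewrite addrC subrK => h.
  by have := q1 (x - y); lra.
have qcont : continuous (q : X -> R^o).
  move=> x; apply/cvgrPdist_lt => e e0; apply/nbhs_ballP; exists e => //= y.
  by rewrite -ball_normE /=; exact: le_lt_trans.
have [|||||E [_ _ Ed Ediff]] := XA setT (q : X -> R^o).
- exact: openT.
- by exists 0.
- by move=> x y t _ _; rewrite inE.
- move=> t x y _ _.
  change (q (t%:num *: (x : X) + (1 - t%:num) *: (y : X)) <=
    t%:num * q x + (1 - t%:num) * q y).
  have t0 : 0 <= t%:num by [].
  have t1 : 0 <= 1 - t%:num by rewrite subr_ge0.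
  apply: le_trans (sq.1 _ _) _.
  rewrite (sublinearZ q)// (sublinearZ q)//.
- exact: continuous_subspaceT.
have [x0 [Ex0 _]] := Ed 0 I setT filterT.
exists x0 => e e0.
have /diff_locally/eqaddoP/(_ (e / 2) (divr_gt0 e0 (ltr0n _ 2))) := Ediff x0 Ex0.
move=> /nbhs_ballP[r /= r0 Hr].
exists (r / 2) => [|z z1]; first by rewrite divr_gt0.
have tz' : `|(r / 2) *: z| <= r / 2.
  by rewrite normrZ ger0_norm ?divr_ge0 ?(ltW r0)// ler_piMr// divr_ge0// ltW.
have tz : `|(r / 2) *: z| < r by apply: le_lt_trans tz' _; lra.
have B1 : ball (0 : X) r ((r / 2) *: z) by rewrite -ball_normE /= sub0r normrN.
have B2 : ball (0 : X) r (- ((r / 2) *: z)) by rewrite -ball_normE /= sub0r opprK.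
have := Hr _ B1; have := Hr _ B2.
set D := 'd _ _.
have DE w : (q \o shift x0 - (cst (q x0) + D)) w = q (w + x0) - (q x0 + D w) by [].
rewrite !{}DE normrN !ler_norml linearN => /andP[_ h1] /andP[_ h2].
rewrite [x0 + _]addrC [x0 - _]addrC.
have : e / 2 * `|(r / 2) *: z| <= e / 2 * (r / 2) by rewrite ler_wpM2l// divr_ge0// ltW.
by move: h1 h2; move: (D _) => w; lra.
Qed.

End asplund_sublinear.

Section separable_subspace.
Context {R : realType} {X : normedModType R}.
Implicit Types (Y : set X) (d : nat -> X) (e : R).

Definition subspace_set Y := Y 0 /\ forall (a : R) x y, Y x -> Y y -> Y (a *: x + y).

Definition dense_seq Y d := (forall n, Y (d n)) /\
  forall y, Y y -> forall e, 0 < e -> exists n, `|y - d n| < e.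

Definition close_on Y e (p q : X -> R) := forall y, Y y -> `|p y - q y| <= e * `|y|.

(** Separability at scale [e] for the dual norm of [Y]. The centres are functionals on all of [X]
    and may lie outside [S]. *)
Definition countably_covered Y e (S : set (X -> R)) :=
  exists P : nat -> X -> R, (forall n, contractive_form (P n)) /\
    forall p, S p -> exists n, close_on Y e p (P n).

Lemma countably_covered_bigcup Y e (S : nat -> set (X -> R)) :
  (forall n, countably_covered Y e (S n)) -> countably_covered Y e (\bigcup_n S n).
Proof.
move=> /choice[P HP].
exists (fun k => let: (i, j) := odflt (0%N, 0%N) (unpickle k) in P i j); split=> [k|p [n _ Snp]].
  by case: (odflt _ _) => i j; exact: (HP i).1.
have [m pm] := (HP n).2 p Snp.
by exists (pickle (n, m)); rewrite pickleK.
Qed.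

Lemma countably_covered_sub Y e (S S' : set (X -> R)) :
  S `<=` S' -> countably_covered Y e S' -> countably_covered Y e S.
Proof. by move=> SS' [P [cP HP]]; exists P; split => // p /SS'; exact: HP. Qed.

Lemma linear_form_sub (p q : X -> R) : linear_form p -> linear_form q ->
  linear_form (fun x => p x - q x).
Proof. by move=> lp lq a x y /=; rewrite lp lq; lra. Qed.

(* Remove from the dual ball its countably many slices (with rational data)
   that are countably covered; nothing left can be separated by a small slice. *)
Lemma uncovered_rough_set Y d e : subspace_set Y -> dense_seq Y d -> 0 < e ->
  ~ countably_covered Y e contractive_form ->
  exists A : set (X -> R), [/\ A `<=` contractive_form, A !=set0 &
    forall a y (r : R), A a -> Y y -> r < a y -> exists a1 a2 z,
      [/\ A a1 /\ A a2, r < a1 y /\ r < a2 y, Y z, `|z| <= 1 & e < a1 z - a2 z]].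
Proof.
move=> [Y0 Ylin] [Yd dY] e0 nc.
pose slice (k : nat * rat) : set (X -> R) :=
  [set p | contractive_form p /\ ratr k.2 < p (d k.1)].
pose A : set (X -> R) := [set p | contractive_form p /\
  forall k, countably_covered Y e (slice k) -> ~ slice k p].
have smallU : countably_covered Y e
    (\bigcup_n [set p | if unpickle n is Some k then
        countably_covered Y e (slice k) /\ slice k p else False]).
  apply: countably_covered_bigcup => n; case: (unpickle n) => [k|].
    have [c|c] := pselect (countably_covered Y e (slice k)).
      by apply: countably_covered_sub c => p [].
    by exists (fun=> cst 0); split=> [m|p []//]; split=> [a x y|x]; rewrite /= ?normr0//; lra.
  by exists (fun=> cst 0); split=> [m|p []//]; split=> [a x y|x]; rewrite /= ?normr0//; lra.
(* Passing to [A] removes only a countable union of countably covered slices, so covering the trace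
   on [A] is enough. *)
have AC (S : set (X -> R)) : S `<=` contractive_form ->
    countably_covered Y e (S `&` A) -> countably_covered Y e S.
  move=> SC SA.
  pose T n := if n is 0%N then S `&` A else (\bigcup_n [set p | if unpickle n is Some k then
        countably_covered Y e (slice k) /\ slice k p else False]).
  apply: (@countably_covered_sub _ _ _ (\bigcup_n T n)); last first.
    by apply: countably_covered_bigcup => -[|n].
  move=> p Sp; have [Ap|] := pselect (A p); first by exists 0%N.
  move=> nAp; exists 1%N => //; apply: contrapT => H; apply: nAp; split; first exact: SC.
  move=> k ck skp; apply: H; exists (pickle k) => //=.
  by rewrite pickleK.
exists A; split.
- by move=> p [].
- apply: contrapT => /nonemptyPn A0; apply: nc; apply: AC => //.
  by rewrite A0 setI0; exists (fun=> cst 0); split=> [m|p []//]; split=> [a x y|x]; rewrite /= ?normr0//; lra.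
move=> a y r Aa Yy ray.
(* A quarter leaves room for replacing [y] by [d n] on both sides and for a rational level in
   between. *)
pose g := (a y - r) / 4.
have g0 : 0 < g by rewrite divr_gt0// subr_gt0.
have [n dn] := dY y Yy g g0.
have dpy p : contractive_form p -> `|p y - p (d n)| < g.
  by move=> [lp p1]; rewrite -linear_formB//; exact: le_lt_trans (p1 _) dn.
have rg : r + g < a y - g by rewrite /g; lra.
have [q] := rat_in_itvoo rg.
rewrite in_itv/= => /andP[rq qa].
have Ca : contractive_form a by case: Aa.
have sa : slice (n, q) a.
  split => //=; apply: lt_trans qa _.
  by have := dpy a Ca; rewrite ltr_norml => /andP[_]; lra.
have ncs : ~ countably_covered Y e (slice (n, q) `&` A).
  move=> c; case: (Aa) => _ /(_ (n, q)); apply => //.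
  by apply: AC c => p [].
have sr p : slice (n, q) p -> r < p y.
  move=> [Cp /= qp]; have := dpy p Cp; rewrite ltr_norml => /andP[+ _].
  by lra.
(* Otherwise the constant sequence [a] would cover the trace of the slice on [A]. *)
have [b [[sb Ab] nb]] : exists b, (slice (n, q) `&` A) b /\ ~ close_on Y e b a.
  apply: contrapT => H; apply: ncs; exists (fun=> a); split=> [_//|p pS].
  by exists 0%N; apply: contrapT => np; apply: H; exists p.
have [z [Yz Hz]] : exists z, Y z /\ e * `|z| < `|b z - a z|.
  apply: contrapT => H; apply: nb => z Yz; rewrite leNgt; apply/negP => hz.
  by apply: H; exists z.
have [lb _] := Ab.1; have [la _] := Ca.
have z0 : 0 < `|z|.
  rewrite normr_gt0; apply/eqP => z0; move: Hz.
  by rewrite z0 (linear_form0 b lb) (linear_form0 a la) subrr !normr0 mulr0 ltxx.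
have YZ (c : R) : Y (c *: z) by rewrite -[_ *: _]addr0; exact: Ylin.
have lz : linear_form (fun x => b x - a x) by exact: linear_form_sub.
have [ba|ba] := leP 0 (b z - a z).
- exists b, a, (`|z|^-1 *: z); split => //.
  + by split; exact: sr.
  + by rewrite normrZ ger0_norm ?invr_ge0// mulVf ?gt_eqF.
  + rewrite (linear_formZ (fun x => b x - a x))// mulrC ltr_pdivlMr//.
    by move: Hz; rewrite ger0_norm.
- exists a, b, (`|z|^-1 *: z); split => //.
  + by split; exact: sr.
  + by rewrite normrZ ger0_norm ?invr_ge0// mulVf ?gt_eqF.
  + rewrite -opprB (linear_formZ (fun x => b x - a x))// -mulrN mulrC ltr_pdivlMr//.
    by move: Hz; rewrite ltr0_norm.
Qed.

End separable_subspace.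

Section asplund_separable_subspace.
Context {R : realType} {X : completeNormedModType R}.
Implicit Types (Y : set X) (d : nat -> X) (e : R).

(* A minimal sublinear function above the support function of a rough set on
   [Y] is nowhere Frechet differentiable: cutting off a slice of it makes some
   slice of the rough set stick out, and that slice has two far apart points. *)
Lemma asplund_countably_covered Y d e : asplund_space X ->
  subspace_set Y -> dense_seq Y d -> 0 < e -> countably_covered Y e contractive_form.
Proof.
move=> XA Ys Yd e0; apply: contrapT => nc.
have [A [AC [a0 Aa0] Ar]] := uncovered_rough_set Y d e Ys Yd e0 nc.
pose l y := sup [set a y | a in A].
have Asup y : has_sup [set a y | a in A].
  split; first by exists (a0 y), a0.
  by exists `|y| => _ [a Aa <-]; exact: le_trans (ler_norm _) ((AC _ Aa).2 y).
have Al a y : A a -> a y <= l y.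
  by move=> Aa; apply: sup_upper_bound; [exact: Asup|exists a].
have l1 y : Y y -> l y <= `|y|.
  move=> _; apply: ge_sup; first exact: (Asup y).1.
  by move=> _ [a Aa <-]; exact: le_trans (ler_norm _) ((AC _ Aa).2 y).
have [s [ss s1 sl smin]] := minimal_sublinear _ Y l sublinear_norm l1.
have [x0 /(_ (e / 2) (divr_gt0 e0 (ltr0n _ 2))) [t t0 Ht]] := sublinear_frechet s XA ss s1.
(* The closing inequality is [e * t - 2 * h < e * t / 2], false for this [h]. *)
pose h := e * t / 8.
have h0 : 0 < h by rewrite divr_gt0// mulr_gt0.
pose r := s x0 - h.
have [Y0 Ylin] := Ys.
have sA a y : A a -> Y y -> a y <= s y.
  by move=> Aa Yy; exact: le_trans (Al a y Aa) (sl y Yy).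
(* If the cut of [s] at [x0] with level [r] exists, it lies strictly below [s] at [x0], so
   minimality makes it fall below [l] somewhere on [Y]; the infimum formula then provides [u]. If
   there is no such cut, [y = 0] and [u = 1] work. *)
have [y [u [a [Yy u0 Aa Hy]]]] : exists y (u : R) a,
    [/\ Y y, 0 < u, A a & s (y - u *: x0) + u * r < a y].
  have [sr|sr] := ltP (s (- x0) + r) 0.
    exists 0, 1, a0; split => //; rewrite scale1r sub0r mul1r.
    by rewrite (linear_form0 a0)//; exact: (AC _ Aa0).1.
  have [s' [ss' s's s'x0 s'app]] := sublinear_cut s x0 r ss sr.
  have [y [Yy Hy]] : exists y, Y y /\ s' y < l y.
    apply: contrapT => H; have := smin s' ss' s's.
    have H' y : Y y -> l y <= s' y.
      by move=> Yy; rewrite leNgt; apply/negP => hy; apply: H; exists y.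
    by move=> /(_ H' x0) E; move: s'x0; rewrite E /r; lra.
  have ly : 0 < l y - s' y by rewrite subr_gt0.
  have [_ [a Aa <-] Ha] := sup_adherent ly (Asup y).
  have {}Ha : s' y < a y by move: Ha; rewrite -/(l y); lra.
  have ay : 0 < a y - s' y by rewrite subr_gt0.
  have [u u0 Hu] := s'app y _ ay.
  exists y, u, a; split => //; last by move: Hu; lra.
  rewrite lt_neqAle u0 andbT; apply/eqP => uE; move: Hu.
  by rewrite -uE scale0r subr0 mul0r; have := sA a y Aa Yy; lra.
have [a1 [a2 [z [[Aa1 Aa2] [ra1 ra2] Yz z1 az]]]] := Ar a y _ Aa Yy Hy.
have Yyz (c : R) : Y (y + c *: z) by rewrite addrC; exact: Ylin.
(* This splitting turns the values of [a1] and [a2] at [z] into a second difference of [s] at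
   [x0]. *)
have E (c : R) : y + (u * c) *: z = (y - u *: x0) + u *: (x0 + c *: z).
  by rewrite scalerDr scalerA addrA subrK.
have S (c : R) : s (y + (u * c) *: z) <= s (y - u *: x0) + u * s (x0 + c *: z).
  by rewrite E -ss.2//; exact: ss.1.
have [la1 _] := AC _ Aa1; have [la2 _] := AC _ Aa2.
have := le_trans (sA a1 _ Aa1 (Yyz (u * t))) (S t).
have := le_trans (sA a2 _ Aa2 (Yyz (u * (- t)))) (S (- t)).
rewrite (linear_formD a1)// (linear_formD a2)// (linear_formZ a1)// (linear_formZ a2)// scaleNr => h2 h1.
have := Ht z z1; rewrite -(ler_pM2l u0) => h3.
have ut : 0 < u * t by rewrite mulr_gt0.
move: az; rewrite -(ltr_pM2l ut) => az.
by move: ra1 ra2; rewrite /r /h => ra1 ra2; nra.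
Qed.

Lemma asplund_dual_dense_seq Y d : asplund_space X -> subspace_set Y -> dense_seq Y d ->
  exists P : nat -> X -> R, (forall n, contractive_form (P n)) /\
    forall p e, contractive_form p -> 0 < e -> exists n, close_on Y e p (P n).
Proof.
move=> XA Ys Yd.
have /choice[P HP] (k : nat) : countably_covered Y k.+1%:R^-1 contractive_form.
  exact: asplund_countably_covered Ys Yd _.
exists (fun k => let: (i, j) := odflt (0%N, 0%N) (unpickle k) in P i j); split=> [k|p e Cp e0].
  by case: (odflt _ _) => i j; exact: (HP i).1.
have [k _ Hk] := near_infty_natSinv_lt (PosNum e0).
have [m pm] := (HP k).2 p Cp.
exists (pickle (k, m)); rewrite pickleK /= => y Yy; apply: le_trans (pm y Yy) _.
by rewrite ler_wpM2r// ltW// Hk/=.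
Qed.

End asplund_separable_subspace.


(** * A smooth convex function on a separable subspace *)

Section dual_limits.
Context {R : realType} {X : normedModType R}.

(** Weak-star compactness of the dual ball: along an ultrafilter each bounded sequence [p k x]
    converges, and linearity and the norm bound pass to the limit. *)
Lemma contractive_ultralimit (p : nat -> X -> R) : (forall k, contractive_form (p k)) ->
  exists (U : set_system nat) (q : X -> R), [/\ ProperFilter U, \oo `<=` U,
    contractive_form q & forall x, (p ^~ x : nat -> R^o) @ U --> (q x : R^o)].
Proof.
move=> Cp; have [U [UU ooU]] := @ultraFilterLemma nat \oo _.
have PU : ProperFilter U := @ultra_proper _ _ UU.
have ex x : exists q : R, (p ^~ x : nat -> R^o) @ U --> (q : R^o).
  have := @segment_compact R (- `|x|) `|x|; rewrite compact_ultra.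
  move=> /(_ ((p ^~ x : nat -> R) @ U) _ _) [||q [_ Hq]]; last by exists q.
  - split=> [|G GG sG]; first exact: fmap_proper_filter.
    apply/seteqP; split=> A; last exact: sG.
    have [//|UA GA] := in_ultra_setVsetC (p ^~ x @^-1` A) UU.
    have /sG GCA : (p ^~ x @ U) (~` A) by [].
    by have [z []] := filter_ex (filterI GA GCA).
  - rewrite /fmap/=; apply: (@filterS _ U _ setT) => [k _ /=|]; last exact: filterT.
    by rewrite in_itv/=; have := (Cp k).2 x; rewrite ler_norml.
have [q Hq] := choice ex.
exists U, q; split => //; split=> [a x y|x].
  have h1 : (fun k => p k (a *: x + y) : R^o) @ U --> (q (a *: x + y) : R^o) by exact: Hq.
  have h2 : (fun k => a * p k x + p k y : R^o) @ U --> (a * q x + q y : R^o).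
    by apply: cvgD; [apply: cvgM; [exact: cvg_cst|exact: Hq]|exact: Hq].
  have E : (fun k => p k (a *: x + y) : R^o) = (fun k => a * p k x + p k y : R^o).
    by apply/funext => k; rewrite (Cp k).1.
  by rewrite E in h1; exact: (cvg_unique _ h1 h2).
have h1 : (fun k => `|p k x| : R^o) @ U --> (`|q x| : R^o) by apply: cvg_norm; exact: Hq.
rewrite leNgt; apply/negP => h.
have := h1; move/cvgrPdist_lt => /(_ (`|q x| - `|x|)); rewrite subr_gt0 => /(_ h).
case/filter_ex => k; have := (Cp k).2 x; have := ler_norm (`|q x| - `|p k x|); lra.
Qed.

End dual_limits.

Section smooth_bump.
Context {R : realType} {X : normedModType R}.
Context (Y : set X) (d : nat -> X) (P : nat -> X -> R) (s : R).
Context (Ys : subspace_set Y) (Yd : dense_seq Y d) (s0 : 0 < s).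
Context (CP : forall n, contractive_form (P n)).
Context (Pd : forall p (e : R), contractive_form p -> 0 < e ->
  exists n, close_on Y e p (P n)).

Implicit Types (p : X -> R) (x y : X).

Let unit_d n := (1 + `|d n|)^-1 *: d n.

(** A slab of the unit ball of [Y]. The supremum of [|p|] on it plays the role of the distance from
    [p] to the span of [P 0, ..., P n]: it is small for large [n], since some [P i] is close to
    [p]. *)
Let K n := [set y | [/\ Y y, `|y| <= 1 &
  forall i, (i <= n)%N -> `|P i y| <= n.+1%:R^-1]].

Let S n (p : X -> R) := sup [set `|p y| | y in K n].

Let b (p : X -> R) n := (S n p ^+ 2 + p (unit_d n) ^+ 2) / 2.

Let Q p := wsum (b p).

Let F y p := p y - s * Q p.

(** The conjugate of [s * Q] restricted to the dual ball. As [Q] takes values between 0 and 1 there,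
    [T] is within [s] of the norm. *)
Let T y := sup [set F y p | p in contractive_form].

Let YZ (a : R) y : Y y -> Y (a *: y).
Proof. by move=> Yy; rewrite -[_ *: _]addr0; apply: Ys.2 => //; exact: Ys.1. Qed.

Let YB x y : Y x -> Y y -> Y (x - y).
Proof. by move=> Yx Yy; rewrite addrC -scaleN1r; exact: Ys.2. Qed.

Let d1_gt0 n : 0 < 1 + `|d n|.
Proof. by rewrite ltr_pwDl. Qed.

Let unit_d1 n : `|unit_d n| <= 1.
Proof.
rewrite normrZ ger0_norm ?invr_ge0 ?(ltW (d1_gt0 n))//.
by rewrite mulrC ler_pdivrMr// mul1r lerDr.
Qed.

Let K0 n : K n 0.
Proof.
split; [exact: Ys.1|by rewrite normr0|move=> i _].
by rewrite (linear_form0 _ (CP i).1) normr0.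
Qed.

Let S_has_sup n p : contractive_form p -> has_sup [set `|p y| | y in K n].
Proof.
move=> Cp; split; first by exists `|p 0|, 0.
by exists 1 => _ [z [_ z1 _] <-]; exact: le_trans (Cp.2 z) z1.
Qed.

Let S_ub n p y : contractive_form p -> K n y -> `|p y| <= S n p.
Proof.
by move=> Cp Ky; apply: sup_upper_bound; [exact: S_has_sup|exists y].
Qed.

Let S_le n p (c : R) : (forall y, K n y -> `|p y| <= c) -> S n p <= c.
Proof.
move=> H; apply: ge_sup; first by exists `|p 0|, 0.
by move=> _ [y Ky <-]; exact: H.
Qed.

Let S_ge0 n p : contractive_form p -> 0 <= S n p.
Proof. by move=> Cp; apply: le_trans (S_ub n p 0 Cp (K0 n)). Qed.

Let S_le_scale n p (c : R) : contractive_form p -> (forall x, `|p x| <= c * `|x|) ->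
  0 <= c -> S n p <= c.
Proof.
move=> Cp pc c0; apply: S_le => y [_ y1 _].
by apply: le_trans (pc y) _; rewrite ler_piMr.
Qed.

Let b_ge0 p n : 0 <= b p n.
Proof. by rewrite divr_ge0// addr_ge0// sqr_ge0. Qed.

Let b_le p n (c : R) : contractive_form p -> (forall x, `|p x| <= c * `|x|) ->
  0 <= c -> b p n <= c ^+ 2.
Proof.
move=> Cp pc c0.
have h1 : S n p ^+ 2 <= c ^+ 2.
  by rewrite ler_sqr ?nnegrE ?S_ge0//; exact: S_le_scale.
have h2 : p (unit_d n) ^+ 2 <= c ^+ 2.
  have : `|p (unit_d n)| <= c by apply: le_trans (pc _) _; rewrite ler_piMr.
  by rewrite ler_norml => /andP[? ?]; nra.
by rewrite /b; lra.
Qed.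

Let b_bounded p : contractive_form p -> bounded_seq (b p).
Proof.
move=> Cp; exists (1 ^+ 2) => n; rewrite ger0_norm ?b_ge0//; apply: b_le => //.
by move=> x; rewrite mul1r; exact: Cp.2.
Qed.

Let Q_ge0 p : contractive_form p -> 0 <= Q p.
Proof. by move=> Cp; apply: wsum_ge0 => [|n]; [exact: b_bounded|exact: b_ge0]. Qed.

Let Q_le p (c : R) : contractive_form p -> (forall x, `|p x| <= c * `|x|) ->
  0 <= c -> Q p <= c ^+ 2.
Proof.
move=> Cp pc c0; rewrite -[leRHS]wsum_cst; apply: wsum_le => [||n].
- exact: b_bounded.
- by exists (c ^+ 2) => _; rewrite ger0_norm// sqr_ge0.
- exact: b_le.
Qed.

Let contractive_scale p (c : R) : contractive_form p -> 0 <= c <= 1 ->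
  contractive_form (fun x => c * p x).
Proof.
move=> [lp p1] /andP[c0 c1]; split=> [a x y|x]; first by rewrite lp; ring.
by rewrite normrM ger0_norm//; have := p1 x; have := normr_ge0 (p x); nra.
Qed.

Let contractive0 : contractive_form (fun _ : X => 0 : R).
Proof. by split=> [a x y|x]; rewrite ?normr0//; ring. Qed.

Let F_le p y : contractive_form p -> F y p <= `|y|.
Proof.
move=> Cp; have := Q_ge0 p Cp; have := Cp.2 y; have := ler_norm (p y).
by rewrite /F; move: s0; nra.
Qed.

Let T_has_sup y : has_sup [set F y p | p in contractive_form].
Proof.
split; first by exists (F y (fun=> 0)), (fun=> 0).
by exists `|y| => _ [p Cp <-]; exact: F_le.
Qed.

Let T_ub y p : contractive_form p -> F y p <= T y.
Proof. by move=> Cp; apply: sup_upper_bound; [exact: T_has_sup|exists p]. Qed.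

Let T_approx y (e : R) : 0 < e -> exists2 p, contractive_form p & T y - e < F y p.
Proof.
by move=> e0; have [_ [p Cp <-] ?] := sup_adherent e0 (T_has_sup y); exists p.
Qed.

Let T_le y : T y <= `|y|.
Proof.
apply: ge_sup; first exact: (T_has_sup y).1.
by move=> _ [p Cp <-]; exact: F_le.
Qed.

Let T_lip x y : T x <= T y + `|x - y|.
Proof.
apply: ge_sup; first exact: (T_has_sup x).1.
move=> _ [p Cp <-]; apply: (@le_trans _ _ (F y p + `|x - y|)); last first.
  by rewrite lerD2r T_ub.
have := Cp.2 (x - y); have := ler_norm (p (x - y)).
by rewrite (linear_formB p _ _ Cp.1) /F; lra.
Qed.

(** The supremum is tested at [c] times a norming functional, where [Q] is at most [c ^+ 2]. Small
    values of [c] are what makes small [T] imply small norm. *)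
Let T_ge y (c : R) : 0 <= c <= 1 -> c * `|y| - s * c ^+ 2 <= T y.
Proof.
move=> c01; have [p Cp py] := norming_form y.
have Ccp := contractive_scale p c Cp c01.
apply: le_trans (T_ub y _ Ccp); rewrite /F py lerB// ler_pM2l//.
have /andP[c0 _] := c01.
apply: Q_le => // x; rewrite normrM (ger0_norm c0) ler_wpM2l//.
exact: Cp.2.
Qed.

(* [S n] is a supremum of pointwise continuous functions of [p], and the tail of
   the weighted sum is small, so [Q] is lower semicontinuous. *)
Let maximizer y : exists2 p, contractive_form p & F y p = T y.
Proof.
have /choice[p Hp] (k : nat) : exists p, contractive_form p /\ T y - k.+1%:R^-1 < F y p.
  have k0 : 0 < k.+1%:R^-1 :> R by [].
  by have [p Cp Hp] := T_approx y _ k0; exists p.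
have Cp k := (Hp k).1.
have [U [q [PU ooU Cq pq]]] := contractive_ultralimit p Cp.
have FU : Filter U by exact: filter_filter.
exists q => //; apply/eqP; rewrite eq_le T_ub//=.
have near_ev x (e : R) : 0 < e -> U [set k | `|q x - p k x| < e].
  by move=> e0; have /cvgrPdist_lt/(_ _ e0) := pq x.
have b_lsc n (e : R) : 0 < e -> U [set k | b q n <= b (p k) n + e].
  move=> e0; pose g := Num.min 1 (e / 8).
  have g0 : 0 < g by rewrite lt_min ltr01 divr_gt0.
  have g1 : g <= 1 by rewrite ge_min lexx.
  have ge : g <= e / 8 by rewrite ge_min lexx orbT.
  have [_ [x Kx <-] Hx] := sup_adherent g0 (S_has_sup n q Cq).
  have UI := @filterI _ U FU _ _ (near_ev x g g0) (near_ev (unit_d n) g g0).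
  apply: (@filterS _ U FU _ _ _ UI) => k [/= h1 h2].
  have h3 : S n q <= S n (p k) + 2 * g.
    have := S_ub n (p k) x (Cp k) Kx; have := ler_distD 0 (q x) (p k x).
    have := lerB_dist (q x) (p k x).
    by move: Hx; rewrite -/(S n q); lra.
  have h4 : S n (p k) <= 1.
    by apply: S_le_scale => // z; rewrite mul1r; exact: (Cp k).2.
  have h5 : `|p k (unit_d n)| <= 1 by apply: le_trans ((Cp k).2 _) _.
  have h6 : q (unit_d n) ^+ 2 <= (p k (unit_d n)) ^+ 2 + 3 * g.
    by move: h2 h5; rewrite ltr_norml ler_norml => /andP[? ?] /andP[? ?]; nra.
  have h7 : S n q ^+ 2 <= S n (p k) ^+ 2 + 8 * g.
    have := S_ge0 n q Cq; have := S_ge0 n (p k) (Cp k); nra.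
  by rewrite /b; lra.
apply/ler_addgt0Pr => e e0.
(* One [g] for the value at [y], one for the defect of [p k], and [2 * s * g] for [s * Q]. *)
pose g := e / (2 + 2 * s).
have g0 : 0 < g by rewrite divr_gt0// addr_gt0// mulr_gt0.
have [N HN] := wsum_le_eps 1 g ler01 g0.
have U1 : U [set k | forall n : 'I_N, b q n <= b (p k) n + g].
  by apply: (@filter_forall _ _ (fun (n : 'I_N) k => b q n <= b (p k) n + g)) => n; exact: b_lsc.
have U2 : U [set k | (k.+1%:R : R)^-1 < g].
  by apply: ooU; have := near_infty_natSinv_lt (PosNum g0).
have [k [[/= k1 k2] k3]] := filter_ex (@filterI _ U FU _ _ (@filterI _ U FU _ _ U1 U2) (near_ev y g g0)).
have QQ : Q q <= Q (p k) + 2 * g.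
  apply: HN; [exact: b_bounded|exact: b_bounded| |].
  - move=> n; apply: (@le_trans _ _ 1).
      rewrite -(expr1n _ 2); apply: b_le => // x.
      by rewrite mul1r; exact: Cq.2.
    by rewrite lerDr b_ge0.
  - by move=> n nN; exact: (k1 (Ordinal nN)).
have := (Hp k).2; rewrite /F => h.
move: k3 => /=; rewrite ltr_norml => /andP[k3 _].
have ge : g * (2 + 2 * s) = e by rewrite divfK// gt_eqF// addr_gt0// mulr_gt0.
move: QQ; rewrite -(ler_pM2l s0) -ge.
by move: k2 h k3; move: (_^-1) (Q q) (Q (p k)) (T y) => v q1 q2 t k2 h k3; lra.
Qed.

(* Pigeonhole on the values of [P 0, ..., P n], rounded to a grid of mesh
   [1 / (n + 1)]. *)
Let K_cover n : exists (I : finType) (z : I -> X),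
  (forall i, Y (z i) /\ `|z i| <= 1) /\
  forall y, Y y -> `|y| <= 1 -> exists i, K n (2^-1 *: (y - z i)).
Proof.
(* The rescaled values fill the closed interval from 0 to [N], so truncation takes [N.+1] values. *)
pose N := (2 * n.+1)%N.
pose v y i := (P i y + 1) * n.+1%:R.
pose cell y := [ffun i : 'I_n.+1 => inord (Num.truncn (v y i)) : 'I_N.+1].
have n0 : 0 < n.+1%:R :> R by [].
have v_itv y i : `|y| <= 1 -> 0 <= v y i <= N%:R.
  move=> y1; have : `|P i y| <= 1 by exact: le_trans ((CP i).2 y) y1.
  rewrite ler_norml => /andP[h1 h2]; apply/andP; split.
    by rewrite mulr_ge0// -lerBlDr sub0r.
  by rewrite /N natrM ler_pM2r// -lerBrDr; lra.
pose good f y := [/\ Y y, `|y| <= 1 & cell y = f].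
(* Empty cells receive the dummy centre 0. *)
pose z f := if pselect (exists y, good f y) is left H then sval (cid H) else 0.
exists {ffun 'I_n.+1 -> 'I_N.+1}, z; split=> [f|y Yy y1].
  rewrite /z; case: pselect => [H|_]; last by rewrite normr0; split => //; exact: Ys.1.
  by case: (cid H) => /= y [].
exists (cell y); rewrite /z; case: pselect => [H|[]]; last by exists y.
case: (cid H) => /= w [Yw w1 cw].
split; first exact/YZ/YB.
  rewrite normrZ ger0_norm// ler_pdivrMl//; apply: le_trans (ler_normB _ _) _.
  by lra.
move=> i ni.
have /(congr1 (fun f : {ffun _ -> _} => f (Ordinal (ni : (i < n.+1)%N)))) := cw.
rewrite !ffunE/= => /(congr1 val)/=.
have trN u : `|u| <= 1 -> (Num.truncn (v u i) < N.+1)%N.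
  by move=> /(v_itv _ i)/andP[h1 h2]; rewrite ltnS truncn_le_nat (le_lt_trans h2)// ltr_nat.
rewrite !inordK ?trN// => E.
have /andP[wi0 _] := v_itv w i w1; have /andP[yi0 _] := v_itv y i y1.
have /andP[w_lo w_hi] := truncn_itv wi0; have /andP[y_lo y_hi] := truncn_itv yi0.
have PL := (CP i).1.
rewrite (linear_formZ (P i))// (linear_formB (P i))//.
rewrite normrM ger0_norm// ler_pdivrMl//.
apply: (@le_trans _ _ n.+1%:R^-1); last by rewrite ler_peMl// ler1n.
rewrite -[leRHS]mul1r ler_pdivlMr//.
rewrite -[ltRHS]natr1 in w_hi; rewrite -[ltRHS]natr1 -E in y_hi; rewrite -E in y_lo.
rewrite -[X in _ * X](gtr0_norm n0) -normrM ler_norml.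
by move: w_lo w_hi y_lo y_hi; rewrite /v mulrBl; lra.
Qed.

Let contractive_mid p q : contractive_form p -> contractive_form q ->
  contractive_form (fun x => 2^-1 * (p x + q x)).
Proof.
move=> [lp p1] [lq q1]; split=> [a x y|x]; first by rewrite lp lq; ring.
rewrite normrM ger0_norm//.
by have := ler_normD (p x) (q x); have := p1 x; have := q1 x; lra.
Qed.

(** The parallelogram identity on each square; for the nonnegative seminorm [S n] subadditivity at
    the midpoint suffices. *)
Let b_mid p q n : contractive_form p -> contractive_form q ->
  b (fun x => 2^-1 * (p x + q x)) n +
    ((S n p - S n q) ^+ 2 + (p (unit_d n) - q (unit_d n)) ^+ 2) / 8
  <= (b p n + b q n) / 2.
Proof.
move=> Cp Cq; set m := (X in b X).
have Sm : S n m <= (S n p + S n q) / 2.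
  apply: S_le => y Ky; rewrite /m normrM ger0_norm//.
  have := S_ub n p y Cp Ky; have := S_ub n q y Cq Ky.
  by have := ler_normD (p y) (q y); lra.
have Sm0 : 0 <= S n m by apply: S_ge0; exact: contractive_mid.
by rewrite /b /m; nra.
Qed.

(** The midpoint of [p] and [q] competes in the supremum, so [s] times the convexity defect of [Q]
    is at most [h / 2]. This defect dominates each weighted term of [b_mid], whence the value of
    [h]. *)
Let maximizing_close y q n (g : R) : contractive_form q -> F y q = T y -> 0 < g ->
  exists2 h : R, 0 < h & forall p, contractive_form p -> T y - h <= F y p ->
    `|S n p - S n q| <= g /\ `|p (unit_d n) - q (unit_d n)| <= g.
Proof.
move=> Cq Fq g0; have w0 := @half_expr_gt0 R n.+1.
exists (s * 2^-1 ^+ n.+1 * g ^+ 2 / 4) => [|p Cp Fp].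
  by rewrite divr_gt0// mulr_gt0 ?exprn_gt0// mulr_gt0.
pose m x := 2^-1 * (p x + q x).
have Cm : contractive_form m by exact: contractive_mid.
pose c k := 2^-1 * b p k + (2^-1 * b q k + -1 * b m k).
have ch k : ((S k p - S k q) ^+ 2 + (p (unit_d k) - q (unit_d k)) ^+ 2) / 8 <= c k.
  by have := b_mid p q k Cp Cq; rewrite /c -/m; lra.
have c0 k : 0 <= c k.
  by apply: le_trans (ch k); rewrite divr_ge0// addr_ge0// sqr_ge0.
have bc : bounded_seq c by do 2?apply: bounded_seqD; apply: bounded_seqZ; exact: b_bounded.
have wc : wsum c = 2^-1 * Q p + (2^-1 * Q q + -1 * Q m).
  rewrite /c wsumD ?wsumD ?wsumZ//; do 2?apply: bounded_seqD;
    try apply: bounded_seqZ; exact: b_bounded.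
have cn := wsum_ge_term c n bc c0; rewrite wc -(ler_pM2l s0) in cn.
have Fm := T_ub y m Cm; have mE : m y = 2^-1 * (p y + q y) by [].
have sw : 0 < s * 2^-1 ^+ n.+1 by rewrite mulr_gt0.
have chn := ch n; rewrite -(ler_pM2l sw) in chn.
have : s * 2^-1 ^+ n.+1 * (((S n p - S n q) ^+ 2 + (p (unit_d n) - q (unit_d n)) ^+ 2) / 8)
    <= s * 2^-1 ^+ n.+1 * (g ^+ 2 / 8).
  apply: (le_trans chn); rewrite -(mulrA _ _ (c n)); apply: (le_trans cn).
  move: Fp Fm; rewrite -Fq /F mE.
  move: (Q p) (Q q) (Q m) (p y) (q y) (2^-1 ^+ _ : R) => Qp Qq Qm py qy w; lra.
rewrite ler_pM2l// => h.
split; rewrite -[leRHS](gtr0_norm g0) -ler_sqr ?nnegrE// !real_normK ?num_real//;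
  have := sqr_ge0 (S n p - S n q); have := sqr_ge0 (p (unit_d n) - q (unit_d n)); lra.
Qed.

(** The ball of [Y] is covered by finitely many translates [z i + 2 K n]. On such a translate
    [p - q] is at most [2 (S n p + S n q)], which is at most [6 g], plus its value at [z i], at most
    [3 g] by comparison with [d (m i)]; hence [g = e / 9]. *)
Let smulian y q (e : R) : contractive_form q -> F y q = T y -> 0 < e ->
  exists2 h : R, 0 < h & forall p, contractive_form p -> T y - h <= F y p ->
    close_on Y e p q.
Proof.
move=> Cq Fq e0; pose g := e / 9.
have g0 : 0 < g by rewrite divr_gt0.
have [n Sq] : exists n, S n q <= g.
  have [i Hi] := Pd q _ Cq (divr_gt0 g0 (ltr0n _ 2)).
  have g2 : 0 < g / 2 by rewrite divr_gt0.
  have [n0 _ Hn0] := near_infty_natSinv_lt (PosNum g2).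
  exists (maxn i n0); apply: S_le => y' [Yy' y1 Hy'].
  have h1 := Hy' i (leq_maxl _ _).
  have /= h2 : (maxn i n0).+1%:R^-1 < g / 2 := Hn0 (maxn i n0) (leq_maxr _ _).
  have h3 := Hi y' Yy'; have h4 := lerB_dist (q y') (P i y').
  have h5 : g / 2 * `|y'| <= g / 2 by rewrite ler_piMr// ltW.
  have h6 := le_lt_trans h1 h2.
  by move: h3 h4 h5 h6; move: `|q y' - _| (g / 2 * _) => u w; lra.
have [I [z [zY Hz]]] := K_cover n.
have /choice[m Hm] (i : I) : exists m, `|z i - d m| < g by apply: Yd.2 => //; exact: (zY i).1.
have near_close k (c : R) : 0 < c -> \forall h \near (0 : R)^'+,
    forall p, contractive_form p -> T y - h <= F y p ->
    `|S k p - S k q| <= c /\ `|p (unit_d k) - q (unit_d k)| <= c.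
  move=> c0; have [h h0 Hh] := maximizing_close y q k c Cq Fq c0.
  near=> h' => p Cp Fp; apply: Hh => //; apply: le_trans Fp.
  by rewrite lerD2l lerN2; near: h'; exact: nbhs_right_ltW.
have near_close_z : \forall h \near (0 : R)^'+, forall i p, contractive_form p -> T y - h <= F y p ->
    `|p (d (m i)) - q (d (m i))| <= g.
  apply: (@filter_forall _ I (fun i h => forall p, contractive_form p -> T y - h <= F y p ->
    `|p (d (m i)) - q (d (m i))| <= g)) => i.
  have c0 : 0 < g / (1 + `|d (m i)|) by rewrite divr_gt0.
  apply: filterS (near_close (m i) _ c0) => h Hh p Cp Fp.
  have := (Hh p Cp Fp).2.
  rewrite (linear_formZ p _ _ Cp.1) (linear_formZ q _ _ Cq.1) -mulrBr normrM.
  by rewrite ger0_norm ?invr_ge0 ?(ltW (d1_gt0 _))// mulrC ler_pM2r// invr_gt0.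
have [h [[h0 h1] h2]] := filter_ex (filterI (filterI (nbhs_right_gt (0 : R))
  (near_close n g g0)) near_close_z).
exists h => // p Cp Fp.
have unit_ball y' : Y y' -> `|y'| <= 1 -> `|p y' - q y'| <= e.
  move=> Yy' y1; have [i Ki] := Hz y' Yy' y1.
  have := S_ub n p _ Cp Ki; have := S_ub n q _ Cq Ki.
  rewrite (linear_formZ p _ _ Cp.1) (linear_formZ q _ _ Cq.1).
  rewrite (linear_formB p _ _ Cp.1) (linear_formB q _ _ Cq.1) !ler_norml.
  move=> /andP[a1 a2] /andP[a3 a4].
  have := h2 i p Cp Fp; rewrite ler_norml => /andP[a5 a6].
  have [+ _] := h1 p Cp Fp; rewrite ler_norml => /andP[a7 a8].
  have := Cp.2 (z i - d (m i)); have := Cq.2 (z i - d (m i)); have a9 := Hm i.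
  rewrite (linear_formB p _ _ Cp.1) (linear_formB q _ _ Cq.1) !ler_norml.
  move=> /andP[b1 b2] /andP[b3 b4].
  have -> : e = 9 * g by rewrite /g; lra.
  by apply/andP; split; lra.
move=> y' Yy'; have [->|y0] := eqVneq y' 0.
  by rewrite (linear_form0 p Cp.1) (linear_form0 q Cq.1) subrr !normr0 mulr0.
have ny0 : 0 < `|y'| by rewrite normr_gt0.
have := unit_ball (`|y'|^-1 *: y') (YZ _ _ Yy') _.
rewrite normrZ ger0_norm ?invr_ge0// mulVf ?gt_eqF// => /(_ (lexx 1)).
rewrite (linear_formZ p _ _ Cp.1) (linear_formZ q _ _ Cq.1) -mulrBr normrM.
by rewrite ger0_norm ?invr_ge0// mulrC ler_pdivrMr.
Unshelve. all: by end_near. Qed.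

(** A near-maximizer at [y + z] remains one at [y] when [z] is small, hence is close on [Y] to the
    maximizer [q] at [y], which is the derivative. The upper estimate is the half of
    differentiability used at a minimum of a function perturbed by [t]. *)
Lemma smooth_bump_from_dense_duals : exists t : X -> R,
  [/\ forall x, 0 <= t x <= `|x|, forall x y, t x <= t y + `|x - y|,
    forall x (c : R), 0 <= c <= 1 -> c * `|x| - s * c ^+ 2 <= t x &
    forall y, exists2 p, contractive_form p & forall e : R, 0 < e ->
      exists2 r : R, 0 < r & forall z, Y z -> `|z| < r ->
        t (y + z) <= t y + p z + e * `|z|].
Proof.
exists T; split => // [x|y].
  by rewrite T_le andbT; have := T_ge x 0; rewrite lexx ler01 => /(_ isT); rewrite mul0r expr0n mulr0 subr0.
have [q Cq Fq] := maximizer y; exists q => // e e0.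
have [h h0 Hh] := smulian y q _ Cq Fq (divr_gt0 e0 (ltr0n _ 2)).
exists (h / 3) => [|z Yz zh]; first by rewrite divr_gt0.
have [->|z0] := eqVneq z 0.
  by rewrite addr0 (linear_form0 q Cq.1) normr0 mulr0 !addr0.
have nz0 : 0 < `|z| by rewrite normr_gt0.
have c0 : 0 < Num.min (e / 2 * `|z|) (h / 3) by rewrite lt_min mulr_gt0 ?divr_gt0.
have [p Cp Fp] := T_approx (y + z) _ c0.
have cz : Num.min (e / 2 * `|z|) (h / 3) <= e / 2 * `|z| by rewrite ge_min lexx.
have ch : Num.min (e / 2 * `|z|) (h / 3) <= h / 3 by rewrite ge_min lexx orbT.
have Fyz : F (y + z) p = F y p + p z by rewrite /F (linear_formD p _ _ Cp.1); lra.
have pz := Cp.2 z; have Tz := T_lip y (y + z).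
rewrite opprD addrA subrr add0r normrN in Tz.
have Fyp : T y - h <= F y p.
  by move: Fp pz; rewrite Fyz ler_norml => Fp /andP[? ?]; lra.
have := Hh p Cp Fyp z Yz; rewrite ler_norml => /andP[? ?].
by move: Fp; rewrite Fyz -Fq; have := T_ub y p Cp; rewrite -Fq; lra.
Qed.

End smooth_bump.


(** * Smooth variational principle *)

Section geometric_cauchy.
Context {R : realType} {X : completeNormedModType R}.

Lemma geometric_cauchy (u : nat -> X) :
  (forall n m, (n <= m)%N -> `|u m - u n| <= 2^-1 ^+ n) ->
  exists l, forall e : R, 0 < e -> exists N, forall n, (N <= n)%N -> `|l - u n| < e.
Proof.
move=> Hu; have : cvg (u @ \oo).
  apply/cauchy_cvgP/cauchy_exP => e e0 /=.
  have [N HN] := @half_expr_lt R e e0.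
  exists (u N); exists N => // n /= Nn.
  rewrite -ball_normE /= distrC; exact: le_lt_trans (Hu N n Nn) HN.
move=> /cvg_ex[l /cvgrPdist_lt Hl]; exists l => e e0.
by have [N _ HN] := Hl e e0; exists N => n /HN.
Qed.

End geometric_cauchy.

Section variational_principle.
Context {R : realType} {X : completeNormedModType R}.

Definition real_lsc (h : X -> R) := forall x a, a < h x ->
  exists2 r : R, 0 < r & forall y, `|y - x| < r -> a < h y.

Lemma real_lscD (h g : X -> R) (c : R) : real_lsc h -> 0 < c ->
  (forall x y, g x <= g y + c * `|x - y|) -> real_lsc (fun x => h x + g x).
Proof.
move=> hl c0 gl x a ha.
have e0 : 0 < (h x + g x - a) / 2 by lra.
have [r r0 Hr] := hl x (h x - (h x + g x - a) / 2) (ltac:(lra)).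
exists (Num.min r ((h x + g x - a) / 2 / c)) => [|y].
  by rewrite lt_min r0 divr_gt0.
rewrite lt_min => /andP[yr]; rewrite ltr_pdivlMr// => yc.
by have := Hr y yr; have := gl x y; rewrite distrC; lra.
Qed.

Context (Y : set X) (T : X -> R) (s : R) (s0 : 0 < s).
Context (Yclosed : forall x, (forall e : R, 0 < e -> exists2 y, Y y & `|x - y| < e) -> Y x).
Context (T_itv : forall x, 0 <= T x <= `|x|) (T_lip : forall x y, T x <= T y + `|x - y|).
Context (T_ge : forall x (c : R), 0 <= c <= 1 -> c * `|x| - s * c ^+ 2 <= T x).

(** For [|x| > r], [T_ge] with [c = min 1 (r / (2 * s))] gives [T x > c * r / 2], which is this
    value. *)
Let modulus (r : R) := Num.min 1 (r / (2 * s)) * (r / 2).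

Let modulus_gt0 r : 0 < r -> 0 < modulus r.
Proof. by move=> r0; rewrite mulr_gt0 ?divr_gt0// lt_min ltr01 divr_gt0// mulr_gt0. Qed.

Let modulus_le r : 0 < r -> modulus r <= r.
Proof.
move=> r0; have : Num.min 1 (r / (2 * s)) <= 1 by rewrite ge_min lexx.
by rewrite /modulus; nra.
Qed.

Let modulusP x r : 0 < r -> T x <= modulus r -> `|x| <= r.
Proof.
move=> r0; apply: contra_leT => xr; rewrite /modulus; set c := Num.min _ _.
have c1 : c <= 1 by rewrite ge_min lexx.
have cs : c * s <= r / 2.
  rewrite -ler_pdivlMr// -mulrA -invfM.
  by rewrite ge_min lexx orbT.
have c0 : 0 < c by rewrite lt_min ltr01 divr_gt0// mulr_gt0.
apply: lt_le_trans (T_ge x c _); last by rewrite ltW.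
by rewrite -subr_gt0; nra.
Qed.

(** The first perturbation has weight [e / 2] and is centred at [x], so the near-minimality
    [e * r / 4] yields [T (u - x) < r / 2]. Since [T] is at least the norm minus [s = r / 2], the
    point [u] is strictly inside the ball. *)
Lemma borwein_preiss (h : X -> R) (x : X) (r e : R) :
  real_lsc h -> Y x -> 0 < e -> 2 * s = r ->
  (forall z, `|z - x| <= r -> h x - e * r / 4 < h z) ->
  exists u (v : nat -> X), [/\ Y u, `|u - x| < r, h u <= h x,
    forall n, Y (v n) /\ `|v n - x| <= r &
    forall z, Y z -> `|z - x| <= r ->
      h u + e * wsum (fun n => T (u - v n)) <= h z + e * wsum (fun n => T (z - v n))].
Proof.
move=> hl Yx e0 sr hx; have r0 : 0 < r by rewrite -sr mulr_gt0.
pose M z := Y z /\ `|z - x| <= r.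
have T0 : T 0 = 0.
  by have := T_itv 0; rewrite normr0 => H; apply/eqP; rewrite eq_le andbC.
(* Adjusted to the weight of the next perturbation: excess at most [eta n] forces distance at most
   [2^-n]. *)
pose eta n := e * 2^-1 ^+ n.+1 * modulus (2^-1 ^+ n).
have en0 n : 0 < e * 2^-1 ^+ n.+1 by rewrite mulr_gt0.
have eta0 n : 0 < eta n by rewrite mulr_gt0// modulus_gt0.
pose H0 v n z := h z + e * \sum_(0 <= i < n) 2^-1 ^+ i.+1 * T (z - v i).
pose state := (nat * (X -> R) * X)%type.
pose inv (t : state) := M t.2 /\ exists B, forall z, M z -> B <= t.1.2 z.
pose next (t t' : {t | inv t}) := let: (n, H, u) := sval t in
  let: (n', H', u') := sval t' in
  [/\ n' = n.+1, H' = (fun z => H z + e * (2^-1 ^+ n.+1 * T (z - u))), H' u' <= H u &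
      forall z, M z -> H' u' <= H' z + eta n'].
have nextP t : {t' | next t t'}.
  apply: cid; case: t => -[[n H] u] [/= Mu [B HB]]; rewrite /next /=.
  pose H' z := H z + e * (2^-1 ^+ n.+1 * T (z - u)).
  have HB' z : M z -> B <= H' z.
    move=> Mz; apply: le_trans (HB z Mz) _; rewrite lerDl.
    by have /andP[T0' _] := T_itv (z - u); rewrite mulr_ge0 ?(ltW e0)// mulr_ge0// ltW.
  have Hu : H' u = H u by rewrite /H' subrr T0 !mulr0 addr0.
  pose m := inf [set H' z | z in M].
  have Hm : has_inf [set H' z | z in M].
    by split; [exists (H' u), u|exists B => _ [z Mz <-]; exact: HB'].
  have mle z : M z -> m <= H' z by move=> Mz; apply: ge_inf; [exact: Hm.2|exists z].
  have [u' [Mu' u'u u'm]] : exists u', [/\ M u', H' u' <= H u & H' u' <= m + eta n.+1].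
    have [Hle|Hlt] := leP (H u) (m + eta n.+1); first by exists u; rewrite Hu.
    have [_ [z Mz <-] Hz] := inf_adherent (eta0 n.+1) Hm.
    by exists z; split => //; rewrite ltW// (lt_trans Hz).
  have I' : inv (n.+1, H', u') by split => //; exists B.
  exists (exist _ (n.+1, H', u') I'); split => // z Mz.
  by apply: le_trans u'm _; rewrite lerD2r mle.
have I0 : inv (0%N, h, x).
  split; first by split => //; rewrite subrr normr0 ltW.
  by exists (h x - e * r / 4) => z [_ zr]; apply/ltW/hx.
have [f [f0 fS]] := dependent_choice nextP (exist _ _ I0).
pose v n := (sval (f n)).2.
have Mv n : M (v n) by exact: (svalP (f n)).1.
have fE n : sval (f n) = (n, H0 v n, v n).
  elim: n => [|n IH].
    rewrite /v f0/= /H0; congr (_, _, _).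
    by apply/funext => z; rewrite big_nil mulr0 addr0.
  have := fS n; rewrite /next IH /v.
  case: (sval (f n.+1)) => -[n' H'] u' [-> -> _ _]/=; congr (_, _, _).
  by apply/funext => z; rewrite /H0 big_nat_recr//= mulrDr addrA.
have HS n z : H0 v n.+1 z = H0 v n z + e * (2^-1 ^+ n.+1 * T (z - v n)).
  by rewrite /H0 big_nat_recr//= mulrDr addrA.
have fS' n : H0 v n.+1 (v n.+1) <= H0 v n (v n) /\
    forall z, M z -> H0 v n.+1 (v n.+1) <= H0 v n.+1 z + eta n.+1.
  by have := fS n; rewrite /next !fE => -[].
have Hmono n m z : (n <= m)%N -> H0 v n z <= H0 v m z.
  elim: m => [|m IH]; first by rewrite leqn0 => /eqP ->.
  rewrite leq_eqVlt => /predU1P[->//|]; rewrite ltnS => /IH nm.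
  apply: le_trans nm _; rewrite HS lerDl.
  by have /andP[T0' _] := T_itv (z - v m); rewrite mulr_ge0 ?(ltW e0)// mulr_ge0// ltW.
have Hdec n m : (n <= m)%N -> H0 v m (v m) <= H0 v n (v n).
  elim: m => [|m IH]; first by rewrite leqn0 => /eqP ->.
  rewrite leq_eqVlt => /predU1P[->//|]; rewrite ltnS => /IH nm.
  exact: le_trans (fS' m).1 nm.
(* Passing from [H0 v n.+1] to [H0 v n.+2] adds at most [eta n.+1] at [v m.+1]. The indices are
   shifted because [v 0] is the starting point [x] and is not [eta]-minimal. *)
have vclose n m : (n <= m)%N -> `|v m.+1 - v n.+1| <= 2^-1 ^+ n.
  rewrite leq_eqVlt => /predU1P[->|nm]; first by rewrite subrr normr0 ltW// half_expr_gt0.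
  apply: (@le_trans _ _ (2^-1 ^+ n.+1)); last by rewrite ler_wiXn2l//; lra.
  apply: modulusP; first exact: half_expr_gt0.
  suff : e * 2^-1 ^+ n.+2 * T (v m.+1 - v n.+1) <= eta n.+1 by rewrite ler_pM2l.
  have h1 := Hmono n.+2 m.+1 (v m.+1) nm; have h2 := Hdec n.+1 m.+1 (ltnW nm).
  have h3 := (fS' n).2 (v m.+1) (Mv _); rewrite (HS n.+1) mulrA in h1.
  by move: h1 h2 h3; move: (_ * T _) (eta _) => a b; lra.
have [u Hu] := geometric_cauchy (fun n => v n.+1) vclose.
have Hu' (c : R) : 0 < c -> exists N, forall n, (N <= n)%N -> `|v n - u| < c.
  by move=> c0; have [N HN] := Hu c c0; exists N.+1 => -[//|n] Nn; rewrite distrC HN.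
have Yu : Y u.
  apply: Yclosed => c /Hu'[N HN]; exists (v N); first exact: (Mv N).1.
  by rewrite distrC HN.
have Hlsc n : real_lsc (H0 v n).
  elim: n => [|n IH].
    have -> // : H0 v 0%N = h by apply/funext => z; rewrite /H0 big_nil mulr0 addr0.
  have -> : H0 v n.+1 = fun z => H0 v n z + e * (2^-1 ^+ n.+1 * T (z - v n)).
    by apply/funext => z; rewrite HS.
  apply: (@real_lscD _ _ (e * 2^-1 ^+ n.+1)) => // z w.
  rewrite !mulrA -mulrDr ler_pM2l//; apply: le_trans (T_lip _ (w - v n)) _.
  by rewrite lerD2l opprB addrA subrK.
have Hlim n (c : R) : 0 < c -> exists N, forall m, (N <= m)%N -> H0 v n u - c < H0 v n (v m).
  move=> c0; have [d d0 Hd] := Hlsc n u (H0 v n u - c) (ltac:(lra)).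
  by have [N HN] := Hu' d d0; exists N => m /HN; exact: Hd.
have HNu n z : M z -> H0 v n u <= h z + e * wsum (fun n => T (z - v n)).
  move=> Mz; apply/ler_addgt0Pr => c c0.
  have c2 : 0 < c / 2 by rewrite divr_gt0.
  have [N HN] := Hlim n (c / 2) c2.
  have [N' HN'] := @half_expr_lt R (c / 2 / e) (divr_gt0 c2 e0).
  pose m := (maxn n (maxn N N')).
  have mN : (N <= m.+1)%N by rewrite leqW// /m !leq_max leqnn !orbT.
  have mN' : (N' <= m.+1)%N by rewrite leqW// /m !leq_max leqnn !orbT.
  have mn : (n <= m.+1)%N by rewrite leqW// /m leq_max leqnn.
  have h1 := HN _ mN; have h2 := Hmono n m.+1 (v m.+1) mn.
  have h3 := (fS' m).2 z Mz.
  have h4 : H0 v m.+1 z <= h z + e * wsum (fun n => T (z - v n)).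
    rewrite lerD2l ler_pM2l//; apply: wsum_ge_partial => [|k _].
      exists (`|z - x| + r) => k.
      have /andP[t0 t1] := T_itv (z - v k); rewrite ger0_norm//; apply: le_trans t1 _.
      have -> : z - v k = (z - x) - (v k - x) by rewrite opprB addrA subrK.
      by apply: le_trans (ler_normB _ _) _; rewrite lerD2l; exact: (Mv k).2.
    by have /andP[] := T_itv (z - v k).
  have h5 : eta m.+1 <= c / 2.
    have h6 : e * 2^-1 ^+ m.+1 <= c / 2.
      rewrite mulrC -ler_pdivlMr//; apply: le_trans (ltW HN').
      by rewrite ler_wiXn2l//; lra.
    apply: le_trans h6; rewrite /eta -mulrA ler_pM2l//.
    apply: le_trans (modulus_le _ (half_expr_gt0 m.+1)).
    by rewrite ler_piMl ?(ltW (modulus_gt0 _ _))// exprn_ile1//; lra.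
  by lra.
have [Mx1 Mx2] := Mv 0%N.
have v0 : v 0%N = x by rewrite /v f0.
have E0 z : H0 v 0%N z = h z by rewrite /H0 big_nil mulr0 addr0.
have E1 z : H0 v 1%N z = h z + e * (2^-1 * T (z - x)) by rewrite HS E0 v0 expr1.
have H1u : h u + e * (2^-1 * T (u - x)) <= h x.
  apply/ler_addgt0Pr => c c0; have [N HN] := Hlim 1%N c c0.
  have := HN (maxn N 1) (leq_maxl _ _); have := Hmono _ _ (v (maxn N 1)) (leq_maxr N 1).
  have := Hdec _ _ (leq0n (maxn N 1)).
  rewrite E0 !E1 v0; lra.
have T0u : 0 <= T (u - x) by have /andP[] := T_itv (u - x).
have hux : h u <= h x.
  by apply: le_trans H1u; rewrite lerDl mulr_ge0 ?mulr_ge0// ltW.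
have uxr : `|u - x| <= r.
  apply/ler_addgt0Pr => c c0; have [N HN] := Hu' c c0.
  have := HN N (leqnn N); have := (Mv N).2.
  have : u - x = (v N - x) - (v N - u) by rewrite opprB [RHS]addrC addrA subrK.
  move=> ->; have := ler_normB (v N - x) (v N - u); lra.
exists u, v; split => //.
- have := T_ge (u - x) 1; rewrite ler01 lexx mul1r expr1n mulr1 => /(_ isT) h1.
  have := hx u uxr => h2.
  have h3 : e * (2^-1 * T (u - x)) < e * (r / 4).
    by move: H1u h2; rewrite -mulrA; lra.
  by move: h3; rewrite ltr_pM2l//; lra.
- move=> z Yz zr; have Hz n := HNu n z (conj Yz zr).
  set C := h z + _ in Hz *; rewrite addrC -lerBrDr -ler_pdivlMl//.
  apply: (@wsum_partial_le _ _ _ 0%N) => [|n _].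
    exists (`|u - x| + r) => k.
    have /andP[t0 t1] := T_itv (u - v k); rewrite ger0_norm//; apply: le_trans t1 _.
    have -> : u - v k = (u - x) - (v k - x) by rewrite opprB addrA subrK.
    by apply: le_trans (ler_normB _ _) _; rewrite lerD2l; exact: (Mv k).2.
  by rewrite ler_pdivlMl//; have := Hz n; rewrite /H0; lra.
Qed.

End variational_principle.

(** * Small subgradients along a separable closed subspace *)

Section subspace_subgradient.
Context {R : realType} {X : completeNormedModType R}.

Definition frechet_subgradient_on (Y : set X) (h : X -> R) (u : X) (l : X -> R) :=
  forall e : R, 0 < e -> exists2 r : R, 0 < r &
    forall z, Y z -> `|z| < r -> h u + l z - e * `|z| <= h (u + z).

Lemma uniform_radius (P : nat -> X -> Prop) N :
  (forall n, exists2 r : R, 0 < r & forall z, `|z| < r -> P n z) ->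
  exists2 r : R, 0 < r & forall z, `|z| < r -> forall n, (n < N)%N -> P n z.
Proof.
move=> HP; elim: N => [|N [r r0 Hr]]; first by exists 1.
have [r' r'0 Hr'] := HP N; exists (Num.min r r') => [|z]; first by rewrite lt_min r0.
rewrite lt_min => /andP[zr zr'] n; rewrite ltnS leq_eqVlt => /predU1P[->|]; first exact: Hr'.
exact: Hr.
Qed.

(** At the minimum of [h] plus [e] times the weighted sum of bumps, minus the derivative of the
    perturbation is a subgradient of [h]; its norm is at most [e] because the weights sum to 1. *)
Lemma asplund_subspace_subgradient (Y : set X) d (h : X -> R) (x : X) (r e : R) :
  asplund_space X -> subspace_set Y -> dense_seq Y d ->
  (forall x, (forall e : R, 0 < e -> exists2 y, Y y & `|x - y| < e) -> Y x) ->
  real_lsc h -> Y x -> 0 < r -> 0 < e ->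
  (forall z, `|z - x| <= r -> h x - e * r / 4 < h z) ->
  exists u l, [/\ Y u, `|u - x| < r, h u <= h x,
    linear_form l /\ (forall z, `|l z| <= e * `|z|) &
    frechet_subgradient_on Y h u l].
Proof.
move=> XA Ys Yd Yc hl Yx r0 e0 hx.
have [P [CP Pd]] := asplund_dual_dense_seq Y d XA Ys Yd.
have s0 : 0 < r / 2 by rewrite divr_gt0.
have [T [T_itv T_lip T_ge T_diff]] := smooth_bump_from_dense_duals Y d P (r / 2) Ys Yd s0 CP Pd.
have r2 : 2 * (r / 2) = r by lra.
have [u [v [Yu ux hux vM umin]]] :=
  borwein_preiss Y T (r / 2) s0 Yc T_itv T_lip T_ge h x r e hl Yx e0 r2 hx.
have /choice[p Hp] (n : nat) : exists p, contractive_form p /\ forall e : R, 0 < e ->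
    exists2 r : R, 0 < r & forall z, Y z -> `|z| < r ->
      T (u - v n + z) <= T (u - v n) + p z + e * `|z|.
  by have [q Cq Hq] := T_diff (u - v n); exists q.
have Cp n := (Hp n).1.
have bp z : bounded_seq (fun n => p n z) by exists `|z| => n; exact: (Cp n).2.
have bT w : bounded_seq (fun n => T (w - v n)).
  exists (`|w - x| + r) => k.
  have /andP[t0 t1] := T_itv (w - v k); rewrite ger0_norm//; apply: le_trans t1 _.
  have -> : w - v k = (w - x) - (v k - x) by rewrite opprB addrA subrK.
  by apply: le_trans (ler_normB _ _) _; rewrite lerD2l; exact: (vM k).2.
have ball_u z : `|z| < r - `|u - x| -> `|u + z - x| <= r.
  by move=> zr; rewrite addrAC; have := ler_normD (u - x) z; lra.
exists u, (fun z => - e * wsum (fun n => p n z)); split => //.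
  split=> [a y z|z].
    rewrite (_ : (fun n => p n (a *: y + z)) = fun n => a * p n y + p n z).
      by rewrite wsumD ?wsumZ//; [ring|exact: bounded_seqZ].
    by apply/funext => n; exact: (Cp n).1.
  rewrite normrM normrN (ger0_norm (ltW e0)) ler_pM2l//.
  by apply: wsum_norm_le => n; exact: (Cp n).2.
move=> g g0; pose c := g / (2 * e).
have c0 : 0 < c by rewrite divr_gt0// mulr_gt0.
have [N HN] := wsum_le_eps 2 c (ltW (ltr0n _ 2)) c0.
have [r' r'0 Hr'] := uniform_radius (fun n z => Y z -> T (u - v n + z) <= T (u - v n) + p n z + c * `|z|) N
  (fun n => let: ex_intro2 q q0 Hq := (Hp n).2 c c0 in ex_intro2 _ _ q q0 (fun z zq Yz => Hq z Yz zq)).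
exists (Num.min r' (r - `|u - x|)) => [|z Yz]; first by rewrite lt_min r'0 subr_gt0.
rewrite lt_min => /andP[zr' zr].
have [->|z0] := eqVneq z 0.
  rewrite addr0 normr0 mulr0 subr0.
  rewrite (_ : (fun n => p n 0) = fun=> 0) ?wsum_cst ?mulr0 ?addr0//.
  by apply/funext => n; exact: linear_form0 (Cp n).1.
have nz0 : 0 < `|z| by rewrite normr_gt0.
(* Divided by the norm of [z], each linearization error is at most 2, uniformly in [n], which
   controls the tail. *)
have h1 : wsum (fun n => `|z|^-1 * T (u + z - v n)) <=
    wsum (fun n => `|z|^-1 * (T (u - v n) + p n z)) + 2 * c.
  have uvz n : u + z - v n = u - v n + z by rewrite addrAC.
  apply: HN; [exact: bounded_seqZ|apply: bounded_seqZ; exact: bounded_seqD|move=> n|move=> n nN].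
    rewrite ler_pdivrMl// mulrDr mulVKf ?gt_eqF// uvz.
    have := T_lip (u - v n + z) (u - v n); rewrite [_ + z - _]addrC addrA addNr add0r.
    by have := (Cp n).2 z; rewrite ler_norml => /andP[? _]; lra.
  rewrite ler_pdivrMl// mulrDr mulVKf ?gt_eqF// uvz [_ * c]mulrC.
  exact: Hr'.
rewrite !wsumZ ?wsumD// in h1; last exact: bounded_seqD.
have Yuz : Y (u + z) by rewrite -[u]scale1r; exact: Ys.2.
have := umin _ Yuz (ball_u z zr).
rewrite -(ler_pM2l nz0) mulrDr !mulVKf ?gt_eqF// in h1.
move: h1; rewrite -(ler_pM2l e0).
have -> : e * (wsum (fun n => T (u - v n)) + wsum (fun n => p n z) + `|z| * (2 * c)) =
    e * wsum (fun n => T (u - v n)) + e * wsum (fun n => p n z) + g * `|z|.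
  by rewrite /c; field; rewrite gt_eqF.
by rewrite mulNr; lra.
Qed.

End subspace_subgradient.


(** * Separable reduction *)

Section constrained_forms.
Context {R : realType} {X : normedModType R}.
Implicit Types (A : set (X * R)) (w : seq (R * (X * R))).

Definition cone_list A w := forall i, i \in w -> 0 <= i.1 /\ A i.2.

Let wsize w : R := \sum_(i <- w) i.1 * i.2.2.
Let wvec w : X := \sum_(i <- w) i.1 *: i.2.1.

(** The infimum over conic lists of [wsize w + e * |z - wvec w|] is sublinear and below both
    [e * |z|] and every constraint; the hypothesis keeps it finite, and Hahn-Banach gives a linear
    form under it. *)
Lemma constrained_form A (e : R) : 0 <= e ->
  (forall w, cone_list A w ->
    0 <= \sum_(i <- w) i.1 * i.2.2 + e * `|\sum_(i <- w) i.1 *: i.2.1|) ->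
  exists l, [/\ linear_form l, forall z, `|l z| <= e * `|z| &
    forall z c, A (z, c) -> l z <= c].
Proof.
move=> e0 Aw.
pose E z := [set wsize w + e * `|z - wvec w| | w in cone_list A].
have nilA : cone_list A [::] by [].
pose q z := inf (E z).
have Elb z : has_lbound (E z).
  exists (- (e * `|z|)) => _ [w cw <-]; have := Aw w cw.
  rewrite -/(wsize w) -/(wvec w).
  have : `|wvec w| <= `|z| + `|z - wvec w|.
    by have := ler_normB z (z - wvec w); rewrite opprB addrC subrK.
  by nra.
have Einf z : has_inf (E z) by split => //; exists (wsize [::] + e * `|z - wvec [::]|), [::].
have qle z w : cone_list A w -> q z <= wsize w + e * `|z - wvec w|.
  by move=> cw; apply: ge_inf => //; exists w.
have qapp z (g : R) : 0 < g -> exists2 w, cone_list A w & wsize w + e * `|z - wvec w| < q z + g.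
  by move=> g0; have [_ [w cw <-] ?] := inf_adherent g0 (Einf z); exists w.
have scaleA w (t : R) : 0 <= t -> cone_list A w ->
    cone_list A [seq (t * i.1, i.2) | i <- w].
  by move=> t0 cw _ /mapP[i /cw[i0 Ai] ->]; split => //=; rewrite mulr_ge0.
have scale_size w (t : R) : wsize [seq (t * i.1, i.2) | i <- w] = t * wsize w.
  by rewrite /wsize big_map mulr_sumr; apply: eq_bigr => i _ /=; rewrite mulrA.
have scale_vec w (t : R) : wvec [seq (t * i.1, i.2) | i <- w] = t *: wvec w.
  by rewrite /wvec big_map scaler_sumr; apply: eq_bigr => i _ /=; rewrite scalerA.
have qZ (t : R) z : 0 < t -> q (t *: z) <= t * q z.
  move=> t0; apply/ler_addgt0Pr => g g0.
  have [w cw Hw] := qapp z (g / t) (divr_gt0 g0 t0).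
  have := qle (t *: z) _ (scaleA w t (ltW t0) cw); rewrite scale_size scale_vec -scalerBr.
  rewrite normrZ gtr0_norm// mulrCA -mulrDr => /le_trans; apply.
  move: Hw; rewrite -(ltr_pM2l t0) [ltRHS]mulrDr [t * (g / t)]mulrC divfK ?gt_eqF//.
  exact: ltW.
have sq : sublinear q.
  split=> [y z|t z t0].
    apply/ler_addgt0Pr => g g0; have g2 : 0 < g / 2 by rewrite divr_gt0.
    have [w cw Hw] := qapp y _ g2; have [w' cw' Hw'] := qapp z _ g2.
    have cww : cone_list A (w ++ w') by move=> i; rewrite mem_cat => /orP[/cw|/cw'].
    have := qle (y + z) _ cww; rewrite /wsize /wvec !big_cat/= -/(wsize _) -/(wsize _) -/(wvec _) -/(wvec _).
    have := ler_normD (y - wvec w) (z - wvec w'); rewrite addrACA -opprD.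
    by move: Hw Hw'; nra.
  apply/eqP; rewrite eq_le qZ//=.
  have := qZ t^-1 (t *: z); rewrite invr_gt0 => /(_ t0).
  by rewrite scalerK ?gt_eqF// mulrC ler_pdivlMr// mulrC.
have [l [ll lq _]] := hahn_banach_form q 0 sq.
exists l; split => // [|z c Azc].
  apply: form_le_norm => // z; apply: le_trans (lq z) _.
  by have := qle z [::] nilA; rewrite /wsize /wvec !big_nil subr0 add0r.
apply: le_trans (lq z) _.
have cz : cone_list A [:: (1, (z, c))] by move=> i; rewrite inE => /eqP ->.
have := qle z _ cz; rewrite /wsize /wvec !big_seq1 /= mul1r scale1r subrr normr0.
by rewrite mulr0 addr0.
Qed.

End constrained_forms.

Section countable_closure.
Context {T : Type} (F : T -> T -> nat -> T) (x : T).

Fixpoint tree_value (t : GenTree.tree nat) : T :=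
  match t with
  | GenTree.Node k (a :: b :: _) => F (tree_value a) (tree_value b) k
  | _ => x
  end.

(** The points generated from [x] by the operations [F] are the values of finite trees labelled by
    naturals, and these are countable. Nodes with fewer than two subtrees denote [x]. *)
Lemma countable_closure : exists d : nat -> T,
  (exists n, d n = x) /\ forall i j k, exists n, d n = F (d i) (d j) k.
Proof.
exists (fun n => if unpickle n is Some t then tree_value t else x); split.
  by exists (pickle (GenTree.Leaf 0%N : GenTree.tree nat)); rewrite pickleK.
have tv n : exists t, (if unpickle n is Some t then tree_value t else x) = tree_value t.
  by case: (unpickle n) => [t|]; [exists t|exists (GenTree.Leaf 0%N)].
move=> i j k; have [a ->] := tv i; have [b ->] := tv j.
by exists (pickle (GenTree.Node k [:: a; b])); rewrite pickleK.
Qed.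

End countable_closure.

Section separable_reduction.
Context {R : realType} {X : completeNormedModType R}.

(** Merely the closure of the range; it is a subspace when the range is stable under adding rational
    multiples. *)
Definition closed_span_of (d : nat -> X) : set X :=
  [set y | forall e : R, 0 < e -> exists n, `|y - d n| < e].

Lemma closed_span_closed d x :
  (forall e : R, 0 < e -> exists2 y, closed_span_of d y & `|x - y| < e) -> closed_span_of d x.
Proof.
move=> H e e0; have e2 : 0 < e / 2 by rewrite divr_gt0.
have [y Yy xy] := H _ e2; have [n yn] := Yy _ e2; exists n.
by have := ler_distD y x (d n); lra.
Qed.

Lemma closed_span_subspace d :
  (forall i j (q : rat), exists n, d n = d i + ratr q *: d j) -> subspace_set (closed_span_of d).
Proof.
move=> Hd; split=> [e e0|a x y Yx Yy e e0].
  have [n dn] := Hd 0%N 0%N (-1); exists n.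
  by rewrite dn rmorphN1 scaleN1r subrr subr0 normr0.
have a1 : 0 < `|a| + 1 by rewrite ltr_pwDr.
have c0 : 0 < Num.min 1 (e / (3 * (`|x| + 1))).
  by rewrite lt_min ltr01 divr_gt0// mulr_gt0// ltr_pwDr.
have [q /[!in_itv]/= /andP[q1 q2]] := rat_in_itvoo (ltac:(lra) : a < a + Num.min 1 (e / (3 * (`|x| + 1)))).
have aq : `|a - ratr q| < Num.min 1 (e / (3 * (`|x| + 1))).
  by rewrite ltr_norml; apply/andP; split; lra.
move: aq; rewrite lt_min => /andP[aq1 aq2].
have [i xi] := Yx (e / 3 / (`|a| + 1)) (divr_gt0 (divr_gt0 e0 (ltr0n _ 3)) a1).
have [j yj] := Yy (e / 3) (divr_gt0 e0 (ltr0n _ 3)).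
have [n dn] := Hd j i q; exists n; rewrite dn.
have -> : a *: x + y - (d j + ratr q *: d i) =
    (a - ratr q) *: x + ratr q *: (x - d i) + (y - d j).
  rewrite scalerBl scalerBr [_ *: x - _ + _]addrA subrK [RHS]addrACA opprD.
  by congr (_ + _); exact: addrC.
apply: le_lt_trans (ler_normD _ _) _.
have := ler_normD ((a - ratr q) *: x) (ratr q *: (x - d i)).
rewrite (normrZ (a - ratr q) x) (normrZ (ratr q) (x - d i)).
have h1 : `|a - ratr q| * `|x| <= e / 3.
  move: aq2; rewrite ltr_pdivlMr ?mulr_gt0 ?ltr_pwDr//.
  by have := normr_ge0 x; have := normr_ge0 (a - ratr q); nra.
have h2 : `|ratr q| * `|x - d i| <= e / 3.
  have h3 : `|ratr q : R| <= `|a| + 1.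
    by have := ler_distD a (ratr q : R) 0; rewrite !subr0 distrC; lra.
  move: xi; rewrite ltr_pdivlMr// => xi; apply: le_trans (ltW xi).
  by rewrite mulrC ler_wpM2l.
by lra.
Qed.

Implicit Types (w : seq (R * (X * nat))) (h : X -> R) (u x : X) (e : R).

Definition convex_list w := (forall i, i \in w -> 0 <= i.1) /\ \sum_(i <- w) i.1 = 1.

(** An entry [(t, (y, n))] has weight [t], point [y] and slack [1 / (n + 1)]. That no cost is below
    [h u] is the Hahn-Banach condition for a subgradient, in terms of values and norms only. *)
Definition list_cost h e u w : R :=
  \sum_(i <- w) i.1 * (h i.2.1 + `|i.2.1 - u| / i.2.2.+1%:R) +
  e * `|\sum_(i <- w) i.1 *: (i.2.1 - u)|.

Lemma ler_norm_convex_sum w (f g : X * nat -> X) (c : R) : convex_list w ->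
  (forall i, i \in w -> `|f i.2 - g i.2| <= c) ->
  `|\sum_(i <- w) i.1 *: f i.2 - \sum_(i <- w) i.1 *: g i.2| <= c.
Proof.
move=> [w0 w1] fg; rewrite -sumrB; apply: le_trans (ler_norm_sum _ _ _) _.
rewrite -[leRHS]mul1r -w1 mulr_suml !big_seq; apply: ler_sum => i iw.
by rewrite -scalerBr normrZ ger0_norm ?w0// ler_wpM2l ?w0// fg.
Qed.

(** The point [u] need not belong to the countable sequence; this moves the base point to a nearby
    member. *)
Lemma list_cost_lip h e u x w : 0 <= e -> convex_list w ->
  list_cost h e x w <= list_cost h e u w + (1 + e) * `|x - u|.
Proof.
move=> e0 cw; rewrite /list_cost mulrDl mul1r addrACA; apply: lerD.
  have E : `|x - u| = \sum_(i <- w) i.1 * `|x - u| by rewrite -mulr_suml cw.2 mul1r.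
  rewrite [X in _ <= _ + X]E -big_split/= !big_seq.
  apply: ler_sum => i iw; rewrite -mulrDr ler_wpM2l ?(cw.1 i iw)// -addrA lerD2l.
  have n1 : (i.2.2.+1%:R : R)^-1 <= 1 by rewrite invf_le1// ler1n.
  have n0 : 0 <= (i.2.2.+1%:R : R)^-1 by [].
  have := ler_distD u i.2.1 x; rewrite (distrC u) => h1.
  have := normr_ge0 (x - u); move: h1.
  move: (`|_ - x|) (`|_ - u|) (`|x - u|) (_^-1) n0 n1 => a b c t; nra.
rewrite -mulrDr ler_wpM2l//.
have := @ler_norm_convex_sum w (fun z => z.1 - x) (fun z => z.1 - u) `|x - u| cw _.
have H i : i \in w -> `|i.2.1 - x - (i.2.1 - u)| <= `|x - u|.
  by move=> _; rewrite opprB addrC addrA subrK distrC.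
move=> /(_ H) h1; have := ler_distD 0 (\sum_(i <- w) i.1 *: (i.2.1 - x)) 0.
rewrite !subr0 => _.
have := lerB_dist (\sum_(i <- w) i.1 *: (i.2.1 - x)) (\sum_(i <- w) i.1 *: (i.2.1 - u)).
by lra.
Qed.

(* [r n] is the radius on which the slack [1 / (n + 1)] is allowed. *)
Lemma frechet_subgradient_of_lists h u e (r : nat -> R) : 0 <= e ->
  (forall n, 0 < r n) ->
  (forall w, convex_list w -> (forall i, i \in w -> `|i.2.1 - u| < r i.2.2) ->
    h u <= list_cost h e u w) ->
  exists l, [/\ linear_form l, forall z, `|l z| <= e * `|z| &
    frechet_subgradient_on setT h u l].
Proof.
move=> e0 r0 Hw.
pose A : set (X * R) := [set zc | exists2 n, `|zc.1| < r n &
  zc.2 = h (u + zc.1) - h u + `|zc.1| / n.+1%:R].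
have [v cv|l [ll le lA]] := constrained_form A e e0.
  have /choice[n Hn] : forall i, exists n, i \in v ->
      `|i.2.1| < r n /\ i.2.2 = h (u + i.2.1) - h u + `|i.2.1| / n.+1%:R.
    move=> i; have [iv|] := boolP (i \in v); last by exists 0%N.
    by have [_ [n h1 h2]] := cv i iv; exists n.
  pose s := \sum_(i <- v) i.1.
  have s_ge0 : 0 <= s by rewrite /s big_seq; apply: sumr_ge0 => i /cv[].
  (* A conic list of total weight 0 is trivial; any other becomes a convex list after division by
     [s]. *)
  have [s0|s0] := eqVneq s 0.
    have v0 i : i \in v -> i.1 = 0.
      move=> iv; apply/eqP; move: s0 => /eqP; rewrite /s big_seq psumr_eq0; last by move=> j /cv[].
      by move=> /allP/(_ i iv); rewrite iv.
    rewrite !big_seq [X in X + _]big1 ?[X in `|X|]big1 ?normr0 ?mulr0 ?addr0//.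
      by move=> i /v0 ->; rewrite scale0r.
    by move=> i /v0 ->; rewrite mul0r.
  have s_gt0 : 0 < s by rewrite lt_neqAle eq_sym s0.
  pose w := [seq (s^-1 * i.1, (u + i.2.1, n i)) | i <- v].
  have cw : convex_list w.
    split; last by rewrite /w big_map/= -mulr_sumr mulVf.
    by move=> _ /mapP[i /cv[i0 _] ->] /=; rewrite mulr_ge0// invr_ge0.
  have := Hw w cw; rewrite /list_cost /w !big_map/=.
  have H i : i \in [seq (s^-1 * i.1, (u + i.2.1, n i)) | i <- v] -> `|i.2.1 - u| < r i.2.2.
    by move=> /mapP[j jv ->] /=; rewrite addrC addKr; exact: (Hn j jv).1.
  move=> /(_ H){H}.
  have -> : \sum_(i <- v) s^-1 * i.1 * (h (u + i.2.1) + `|u + i.2.1 - u| / (n i).+1%:R) =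
      h u + s^-1 * \sum_(i <- v) i.1 * i.2.2.
    have E : h u = \sum_(i <- v) s^-1 * i.1 * h u.
      by rewrite -mulr_suml -mulr_sumr mulVf// mul1r.
    rewrite [X in X + _]E mulr_sumr -big_split/= !big_seq; apply: eq_bigr => i iv.
    by rewrite (Hn i iv).2 [u + _]addrC addrK; ring.
  have -> : \sum_(i <- v) (s^-1 * i.1) *: (u + i.2.1 - u) = s^-1 *: \sum_(i <- v) i.1 *: i.2.1.
    rewrite scaler_sumr; apply: eq_bigr => i _.
    by rewrite [u + _]addrC addrK scalerA.
  rewrite normrZ (ger0_norm (ltW (_ : 0 < s^-1))) ?invr_gt0// mulrCA -addrA -mulrDr lerDl.
  by rewrite pmulr_rge0// invr_gt0.
exists l; split => // g g0.
have [n _ Hn] := near_infty_natSinv_lt (PosNum g0).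
exists (r n) => // z _ zr.
have := lA z (h (u + z) - h u + `|z| / n.+1%:R); have /= Hg := Hn n (leqnn n).
have h1 : `|z| / n.+1%:R <= g * `|z| by rewrite mulrC ler_wpM2r// ltW.
have h2 : A (z, h (u + z) - h u + `|z| / n.+1%:R) by exists n.
by move=> /(_ h2); move: h1; move: (_ / _) (g * _) => a b; lra.
Qed.

(** Finitely many rational radii and a rational level, so that for base points in a sequence there
    are only countably many requirements. *)
Let good_list h e (a : X) (s : seq rat) (t : rat) w :=
  [/\ convex_list w, list_cost h e a w < ratr t &
    forall i, i \in w -> (i.2.2 < size s)%N /\ `|i.2.1 - a| < ratr (nth 0 s i.2.2)].

(* Whenever some list has small cost at a point of the sequence, so does a list
   with entries in the sequence: only rational data are prescribed. *)
Lemma reflecting_seq h e x : exists d : nat -> X,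
  [/\ exists n, d n = x,
    forall i j (q : rat), exists n, d n = d i + ratr q *: d j &
    forall n s t, (exists w, good_list h e (d n) s t w) ->
      exists2 w, good_list h e (d n) s t w & forall i, i \in w -> exists m, d m = i.2.1].
Proof.
pose W a s t : seq (R * (X * nat)) := xget [::] (good_list h e a s t).
(* The code [k] asks either for a rational combination or for the [i]-th point of the list chosen
   for [a], [s], [t]. *)
pose F a b k := match (unpickle k : option (rat + (seq rat * rat * nat))) with
  | Some (inl q) => a + ratr q *: b
  | Some (inr (s, t, i)) => (nth (0, (0, 0%N)) (W a s t) i).2.1
  | None => a end.
have [d [dx dF]] := countable_closure F x.
exists d; split => // [i j q|n s t [w Hw]].
  have [n dn] := dF i j (pickle (inl q : rat + (seq rat * rat * nat))).
  by exists n; rewrite dn /F pickleK.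
exists (W (d n) s t); first exact: (xgetPex [::] (ex_intro _ w Hw)).
move=> i iW; have [m dm] := dF n n
  (pickle (inr (s, t, index i (W (d n) s t)) : rat + (seq rat * rat * nat))).
by exists m; rewrite dm /F pickleK nth_index.
Qed.

(** A list violating the Hahn-Banach condition at [u] would, from a nearby member of the sequence,
    be reflected into a list with points in [Y], against the subgradient along [Y]. The rational
    radii [s n] lie strictly between [g n / 2] and [g n], so they tolerate moving the base point
    there and back. *)
Theorem asplund_frechet_subgradient h x (r e : R) : asplund_space X ->
  real_lsc h -> 0 < r -> 0 < e -> (forall z, `|z - x| <= r -> h x - e * r / 4 < h z) ->
  exists u l, [/\ `|u - x| < r, h u <= h x, linear_form l,
    forall z, `|l z| <= e * `|z| & frechet_subgradient_on setT h u l].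
Proof.
move=> XA hl r0 e0 hx.
have [d [[n0 dx] dQ dW]] := reflecting_seq h e x.
pose Y := closed_span_of d.
have Ys : subspace_set Y by exact: closed_span_subspace.
have Yd n : Y (d n) by move=> c c0; exists n; rewrite subrr normr0.
have Yx : Y x by rewrite -dx.
have [u [l [Yu ux hux [ll le] ls]]] := asplund_subspace_subgradient Y d h x r e XA Ys
  (conj Yd (fun y Yy => Yy)) (@closed_span_closed d) hl Yx r0 e0 hx.
have /choice[g Hg] (n : nat) : exists g, 0 < g /\ forall z, Y z -> `|z| < g ->
    h u + l z - n.+1%:R^-1 * `|z| <= h (u + z).
  by have [g g0 Hg] := ls (n.+1%:R^-1) (ltac:(by [])); exists g.
have g0 n : 0 < g n by exact: (Hg n).1.
have /choice[s Hs] (n : nat) : exists s : rat, g n / 2 < ratr s < g n.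
  have gn : g n / 2 < g n by have := g0 n; lra.
  by have [s] := rat_in_itvoo gn; rewrite in_itv/=; exists s.
have g20 n : 0 < g n / 2 by rewrite divr_gt0.
have [|l' [ll' le' ls']] := frechet_subgradient_of_lists h u e (fun n => g n / 2) (ltW e0) g20.
  move=> w cw wg; rewrite leNgt; apply/negP => hw.
  (* One third of the gap for each move of the base point, one for the rational level [t]. *)
  pose c := (h u - list_cost h e u w) / 3.
  have c0 : 0 < c by rewrite divr_gt0// subr_gt0.
  have Hc : h u = list_cost h e u w + 3 * c by rewrite /c; lra.
  have ct : list_cost h e u w + c < h u - c by lra.
  have [t /[!in_itv]/= /andP[t1 t2]] := rat_in_itvoo ct.
  pose N := (\max_(i <- w) i.2.2).+1.
  have wN i : i \in w -> (i.2.2 < N)%N by move=> iw; rewrite ltnS; exact: leq_bigmax_seq.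
  have [p p0 Hp] := @uniform_radius R X (fun n z => g n / 2 + `|z| <= ratr (s n) /\
      ratr (s n) + `|z| <= g n) N (fun n => ltac:(
    exists (Num.min (ratr (s n) - g n / 2) (g n - ratr (s n)));
    [by have /andP[? ?] := Hs n; rewrite lt_min !subr_gt0; apply/andP; split
    |by move=> z; rewrite lt_min => /andP[? ?]; split; lra])).
  have e1 : 0 < 1 + e by rewrite addr_gt0.
  have pc0 : 0 < Num.min p (c / (1 + e)) by rewrite lt_min p0 divr_gt0.
  have [n un] := Yu _ pc0.
  move: un; rewrite lt_min => /andP[un1]; rewrite ltr_pdivlMr// mulrC => un2.
  pose S := [seq s i | i <- iota 0 N].
  have nthS i : (i < N)%N -> nth 0 S i = s i.
    by move=> iN; rewrite (nth_map 0%N) ?size_iota// nth_iota.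
  have [w' [cw' w't w'S] w'd] : exists2 w, good_list h e (d n) S t w &
      forall i, i \in w -> exists m, d m = i.2.1.
    apply: dW; exists w; split => //.
      apply: le_lt_trans (list_cost_lip h e u (d n) w (ltW e0) cw) _.
      by rewrite distrC; apply: lt_trans t1; rewrite ltrD2l.
    move=> i iw; rewrite /S size_map size_iota; split; first exact: wN.
    rewrite nthS ?wN//; have [h1 _] := Hp _ un1 _ (wN i iw).
    by have := ler_distD u i.2.1 (d n); have := wg i iw; lra.
  have Yw' i : i \in w' -> Y (i.2.1 - u).
    move=> iw; have [m dm] := w'd i iw.
    by rewrite -dm addrC -scaleN1r; exact: Ys.2.
  have : list_cost h e u w' < h u.
    apply: le_lt_trans (list_cost_lip h e (d n) u w' (ltW e0) cw') _.
    by lra.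
  rewrite ltNge => /negP; apply.
  have h1 : h u + l (\sum_(i <- w') i.1 *: (i.2.1 - u)) <=
      \sum_(i <- w') i.1 * (h i.2.1 + `|i.2.1 - u| / i.2.2.+1%:R).
    have lsum : l (\sum_(i <- w') i.1 *: (i.2.1 - u)) = \sum_(i <- w') i.1 * l (i.2.1 - u).
      elim: (w') => [|i v IH]; first by rewrite !big_nil linear_form0.
      by rewrite !big_cons ll IH.
    have E : h u = \sum_(i <- w') i.1 * h u by rewrite -mulr_suml cw'.2 mul1r.
    rewrite lsum E -big_split/= !big_seq; apply: ler_sum => i iw.
    rewrite -mulrDr ler_wpM2l ?(cw'.1 i iw)//.
    have [iN iS] := w'S i iw; rewrite /S size_map size_iota in iN.
    rewrite nthS// in iS; have [_ h2] := Hp _ un1 _ iN.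
    have iu : `|i.2.1 - u| < g i.2.2.
      by have := ler_distD (d n) i.2.1 u; rewrite (distrC (d n)); lra.
    have := (Hg i.2.2).2 _ (Yw' i iw) iu; rewrite [u + _]addrC subrK mulrC.
    by move: (_ / _) => a; lra.
  apply: le_trans (lerD h1 (lexx _)).
  by have := le (\sum_(i <- w') i.1 *: (i.2.1 - u)); rewrite ler_norml => /andP[? _]; lra.
by exists u, l'.
Qed.

End separable_reduction.


(** * Normal cones and subdifferentials *)

Section dual_unit_ball.
Context {R : realType} {X : normedModType R}.
Implicit Types (p : X -> R^o) (c : R).

Lemma bounded_form_cont_dual p c : linear_form p -> 0 < c ->
  (forall x, `|p x| <= c * `|x|) -> cont_dual p.
Proof.
move=> lp c0 pc; split=> // x; apply/cvgrPdist_lt => e e0.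
apply/nbhs_ballP; exists (e / c) => [|y]; first by rewrite /= divr_gt0.
rewrite -ball_normE /= ltr_pdivlMr// mulrC => xy.
by rewrite -(linear_formB p)//; exact: le_lt_trans xy.
Qed.

Lemma dual_unit_ballE p : dual_unit_ball X p -> contractive_form p.
Proof.
move=> [[lp cp] p1]; split=> // x.
have lp' : linear_form p by [].
have [c c0 Hc] : exists2 c : R, 0 < c & forall y, `|y| < c -> `|p y| < 1.
  have /cvgrPdist_lt/(_ 1 ltr01)/nbhs_ballP[c /= c0 Hc] := cp 0.
  exists c => // y yc; have := Hc y; rewrite -ball_normE/= sub0r normrN.
  by rewrite (linear_form0 p)// sub0r normrN; exact.
(* The value of [sup] bounds the set only if the set is bounded, which continuity at 0 ensures. *)
have hs : has_sup [set `|p y| | y in [set y : X | `|y| <= 1]].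
  split; first by exists `|p 0|, 0 => //=; rewrite normr0.
  exists (2 / c) => _ [y /= y1 <-]; rewrite ler_pdivlMr//.
  have := Hc ((c / 2) *: y); rewrite (linear_formZ p)// normrM normrZ.
  rewrite gtr0_norm ?divr_gt0// => H.
  have : c / 2 * `|y| < c by have := normr_ge0 y; nra.
  by move=> /H; lra.
have [->|x0] := eqVneq x 0; first by rewrite (linear_form0 p)// !normr0.
have nx0 : 0 < `|x| by rewrite normr_gt0.
have : `|p (`|x|^-1 *: x)| <= 1.
  apply: le_trans p1; apply: (sup_upper_bound hs); exists (`|x|^-1 *: x) => //=.
  by rewrite normrZ ger0_norm ?invr_ge0// mulVf// gt_eqF.
by rewrite (linear_formZ p)// normrM ger0_norm ?invr_ge0// mulrC ler_pdivrMr// mul1r.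
Qed.

Lemma contractive_dual_unit_ball p : contractive_form p -> dual_unit_ball X p.
Proof.
move=> [lp p1]; split.
  by apply: (@bounded_form_cont_dual _ 1) => // x; rewrite mul1r.
apply: ge_sup; first by exists `|p 0|, 0 => //=; rewrite normr0.
by move=> _ [y /= y1 <-]; exact: le_trans (p1 y) y1.
Qed.

Lemma frechet_normal_coneP (A : set X) (a : X) p : cont_dual p ->
  frechet_normal_cone A a p <-> forall e : R, 0 < e -> exists2 r : R, 0 < r &
    forall x, A x -> `|x - a| < r -> p (x - a) <= e * `|x - a|.
Proof.
move=> cp; have lp : linear_form p := cp.1; split=> [[_ H] e e0|H].
  have : (limf_esup (fun x => (p (x - a) / `|x - a|)%R%:E) (within A a^') < e%:E)%E.
    by apply: le_lt_trans H _; rewrite lte_fin.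
  move=> /ereal_inf_lt[_ [V HV <-] Ve].
  move: HV; rewrite /within/= => /nbhs_ballP[r /= r0 Hr].
  exists r => // x Ax xr.
  have [->|xa] := eqVneq x a; first by rewrite subrr (linear_form0 p)// normr0 mulr0.
  have Vx : V x by apply: Hr => //; rewrite -ball_normE/= distrC.
  have : ((p (x - a) / `|x - a|)%R%:E < e%:E)%E.
    by apply: le_lt_trans Ve; apply: ereal_sup_ubound; exists x.
  by rewrite lte_fin ltr_pdivrMr ?normr_gt0 ?subr_eq0// => /ltW.
split => //; apply/lee_addgt0Pr => e e0; rewrite add0e.
have [r r0 Hr] := H e e0.
apply: (@le_trans _ _ (ereal_sup ((fun x => (p (x - a) / `|x - a|)%R%:E) @`
    [set x | A x /\ (x != a /\ `|x - a| < r)]))).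
  apply: ereal_inf_lbound; exists [set x | A x /\ (x != a /\ `|x - a| < r)] => //.
  rewrite /within/=; apply/nbhs_ballP; exists r => //= x.
  by rewrite -ball_normE/= distrC.
apply: ge_ereal_sup => _ [x [Ax [xa xr]] <-].
by rewrite lee_fin ler_pdivrMr ?normr_gt0 ?subr_eq0//; exact: Hr.
Qed.

End dual_unit_ball.

Section smooth_positive_part.
Context {R : realType}.

(** The function is [(t + sqrt (t^2 + k^2)) / 2]. Its derivative is positive and at most 1; the
    quadratic bound follows from [2 * q t * (q (t + s) - q t) <= q (t + s) ^+ 2 - q t ^+ 2]. *)
Lemma smooth_positive_part (k : R) : 0 < k -> exists g : R -> R,
  [/\ g 0 = k / 2, forall t, 0 <= g t /\ t <= g t,
    forall t t', t <= t' -> g t <= g t' <= g t + (t' - t) &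
    forall t, exists a c : R, [/\ 0 < a, a <= 1, 0 <= c &
      forall s, g (t + s) <= g t + a * s + c * s ^+ 2]].
Proof.
move=> k0; pose q t := Num.sqrt (t ^+ 2 + k ^+ 2).
have k20 : 0 < k ^+ 2 by rewrite exprn_gt0.
have q2 t : q t ^+ 2 = t ^+ 2 + k ^+ 2.
  by rewrite sqr_sqrtr// addr_ge0// sqr_ge0.
have q0 t : 0 < q t by rewrite sqrtr_gt0 ltr_wpDl// sqr_ge0.
have qt t : t < q t /\ - t < q t.
  by have := q2 t; have := q0 t; split; nra.
exists (fun t => (t + q t) / 2); split.
- by rewrite /q expr0n/= !add0r sqrtr_sqr gtr0_norm.
- by move=> t; have := qt t; lra.
- move=> t t' tt'; have [a1 a2] := qt t; have [a3 a4] := qt t'.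
  have := q2 t; have := q2 t'; have := q0 t; have := q0 t'.
  move: (q t) (q t') a1 a2 a3 a4 => x y a1 a2 a3 a4 y0 x0 y2 x2.
  have E : (y - x) * (y + x) = (t' - t) * (t' + t) by nra.
  have h1 : - (t' - t) <= y - x by nra.
  have h2 : y - x <= t' - t by nra.
  by apply/andP; split; lra.
- move=> t; have [a1 a2] := qt t.
  exists ((1 + t / q t) / 2), ((4 * q t)^-1); split.
  + have : -1 < t / q t by rewrite ltr_pdivlMr// mulN1r; lra.
    by lra.
  + have : t / q t <= 1 by rewrite ler_pdivrMr// mul1r ltW.
    by lra.
  + by rewrite invr_ge0 mulr_ge0// ltW.
  move=> s; have h : q (t + s) <= q t + (2 * t * s + s ^+ 2) / (2 * q t).
    have E : (2 * t * s + s ^+ 2) = q (t + s) ^+ 2 - q t ^+ 2 by rewrite !q2; ring.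
    rewrite E -lerBlDl ler_pdivlMr ?mulr_gt0//.
    by have := sqr_ge0 (q (t + s) - q t); lra.
  have -> : (t + q t) / 2 + (1 + t / q t) / 2 * s + (4 * q t)^-1 * s ^+ 2 =
      (t + s + (q t + (2 * t * s + s ^+ 2) / (2 * q t))) / 2.
    by field; rewrite gt_eqF.
  by lra.
Qed.

End smooth_positive_part.

(** * From normals of a set to subgradients of a function bounding the distance *)

Section subgradients.
Context {R : realType} {X : completeNormedModType R}.

(** With [v] in [A] almost nearest to [x], [p (x - v)] is at most the distance up to
    [e / 2 * |x - a|], and [p (v - a)] is small by normality since [|v - a| <= 3 * |x - a|]; hence
    [r / 3] and [e / 6]. *)
Lemma normal_le_dist (A : set X) (a : X) (p : X -> R) : contractive_form p -> A a ->
  (forall e : R, 0 < e -> exists2 r : R, 0 < r &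
    forall x, A x -> `|x - a| < r -> p (x - a) <= e * `|x - a|) ->
  forall e : R, 0 < e -> exists2 r : R, 0 < r &
    forall x (D : R), `|x - a| < r -> (dist_set x A <= D%:E)%E ->
      p (x - a) <= D + e * `|x - a|.
Proof.
move=> [lp p1] Aa Hp e e0; have [r r0 Hr] := Hp (e / 6) (divr_gt0 e0 (ltr0n _ 6)).
exists (r / 3) => [|x D xr xD]; first by rewrite divr_gt0.
have [->|xa] := eqVneq x a.
  rewrite subrr (linear_form0 p)// normr0 mulr0 addr0 -lee_fin.
  apply: le_trans xD; apply: le_ereal_inf_tmp => _ [y _ <-].
  by rewrite lee_fin.
have n0 : 0 < `|x - a| by rewrite normr_gt0 subr_eq0.
have [v [Av xvD xva]] : exists v, [/\ A v, `|x - v| <= D + e / 2 * `|x - a| &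
    `|x - v| <= 2 * `|x - a|].
  have [h|h] := leP `|x - a| (D + e / 2 * `|x - a|).
    by exists a; split => //; lra.
  have : (dist_set x A < (D + e / 2 * `|x - a|)%:E)%E.
    by apply: le_lt_trans xD _; rewrite lte_fin ltrDl mulr_gt0// divr_gt0.
  move=> /ereal_inf_lt[_ [v Av <-]]; rewrite lte_fin => vD.
  exists v; split => //; first exact: ltW.
  by apply: le_trans (ltW (lt_trans vD h)) _; rewrite ler_peMl ?ler1n.
have va : `|v - a| <= 3 * `|x - a|.
  by have := ler_distD x v a; rewrite (distrC v x); lra.
have h1 : `|v - a| < r by lra.
have := Hr v Av h1; have := ler_norm (p (x - v)); have := p1 (x - v).
have -> : p (x - a) = p (x - v) + p (v - a) by rewrite -linear_formD// addrA subrK.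
move=> ? ? ?.
have : e / 6 * `|v - a| <= e / 6 * (3 * `|x - a|) by rewrite ler_wpM2l// divr_ge0// ltW.
by lra.
Qed.

(* [phi] plays the role of [psi \o g], with [a] the derivative of [psi] at [g u]. *)
Lemma subgradient_chain (g phi : X -> R) (u : X) (m : X -> R) (a c M : R) :
  real_lsc g -> 0 < a -> 0 <= c -> 0 <= M -> (forall z, `|m z| <= M * `|z|) ->
  (forall z, phi (u + z) <= phi u + a * (g (u + z) - g u) + c * (g (u + z) - g u) ^+ 2) ->
  frechet_subgradient_on setT phi u m ->
  frechet_subgradient_on setT g u (fun z => a^-1 * m z).
Proof.
move=> gl a0 c0 M0 mM phi_le Hm e e0.
have ae0 : 0 < a * e by rewrite mulr_gt0.
have [r1 r10 Hr1] := Hm (a * e / 2) (divr_gt0 ae0 (ltr0n _ 2)).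
have c1 : 0 < 2 * (c + 1) by rewrite mulr_gt0// ltr_wpDl.
(* Semicontinuity bounds the increment [s] of [g] only from below; above this threshold a negative
   [s] satisfies [c * s ^+ 2 <= - (a * s) / 2]. *)
have [r2 r20 Hr2] := gl u (g u - a / (2 * (c + 1))) (ltac:(by rewrite ltrBlDr ltrDl divr_gt0)).
pose B := 2 * (M + a * e) / a.
have B0 : 0 < B by rewrite divr_gt0// mulr_gt0// ltr_wpDl.
have cB0 : 0 < 2 * (c * B ^+ 2 + 1) by rewrite mulr_gt0// ltr_wpDl// mulr_ge0// sqr_ge0.
exists (Num.min r1 (Num.min r2 (a * e / (2 * (c * B ^+ 2 + 1))))) => [|z _].
  by rewrite !lt_min r10 r20 divr_gt0.
rewrite !lt_min => /and3P[zr1 zr2]; rewrite ltr_pdivlMr// => zr3.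
have := Hr1 z I zr1; have := phi_le z.
have uz : `|u + z - u| < r2 by rewrite addrC addKr.
have := Hr2 _ uz; have := mM z; rewrite ler_norml.
set s := g (u + z) - g u; move=> /andP[mz' mz] gs h1 h2.
have {gs} s_lb : - (a / (2 * (c + 1))) < s by rewrite /s; lra.
have {h1 h2} key : m z - a * e / 2 * `|z| <= a * s + c * s ^+ 2 by lra.
suff : m z <= a * (s + e * `|z|).
  by rewrite -ler_pdivrMl// /s; lra.
have z0 := normr_ge0 z.
have BE : a * B = 2 * (M + a * e) by rewrite /B; field; rewrite gt_eqF.
have quad : c * s ^+ 2 <= - (a * s) / 2 \/ 0 <= s.
  have [s0|s0] := leP 0 s; [by right|left].
  have h3 : - s * (2 * (c + 1)) < a by rewrite -ltr_pdivlMr//; lra.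
  by nra.
(* If the claim fails, large upward jumps are excluded as well and [|s| <= B * |z|]; the quadratic
   term is then absorbed by [a * e / 2 * |z|]. *)
rewrite leNgt; apply/negP => hlt.
have s_ub : `|s| <= B * `|z|.
  rewrite -(ler_pM2l a0) mulrA BE -[X in X * `|s|](gtr0_norm a0) -normrM ler_norml.
  have := mulr_ge0 M0 z0.
  have := mulr_ge0 (ltW ae0) z0; case: quad => [hq|s0] h3 h4; apply/andP; split; nra.
have : c * s ^+ 2 <= c * (B * `|z|) ^+ 2.
  rewrite ler_wpM2l// -real_normK ?num_real// ler_sqr ?nnegrE ?normr_ge0//.
  by rewrite mulr_ge0// ltW.
have : c * (B * `|z|) ^+ 2 <= a * e / 2 * `|z|.
  have -> : c * (B * `|z|) ^+ 2 = c * B ^+ 2 * `|z| * `|z| by ring.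
  by nra.
lra.
Qed.

Lemma real_lsc_comp (g : X -> R) (phi : R -> R) (c : R) : real_lsc g -> 0 < c ->
  (forall t t', t <= t' -> phi t <= phi t' <= phi t + c * (t' - t)) ->
  real_lsc (fun x => phi (g x)).
Proof.
move=> gl c0 Hphi x b bx; pose t := g x - (phi (g x) - b) / (2 * c).
have h0 : 0 < (phi (g x) - b) / (2 * c) by rewrite divr_gt0 ?mulr_gt0// subr_gt0.
have tx : t < g x by rewrite /t; lra.
have [r r0 Hr] := gl x t tx; exists r => // y /Hr ty.
have /andP[_ h1] := Hphi t (g x) (ltW tx); have /andP[h2 _] := Hphi t (g y) (ltW ty).
apply: lt_le_trans h2.
have : c * (g x - t) = (phi (g x) - b) / 2 by rewrite /t; field; rewrite gt_eqF.
by lra.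
Qed.

(** The multiplier [a] is [tau] times the derivative of the smoothed positive part at [g u], hence
    in [(0, tau]], and [w] is [p + l] divided by it. The bound on [w] later gives its continuity. *)
Lemma asplund_positive_part_subgradient (g : X -> R) (x : X) (p : X -> R) (tau : R) :
  asplund_space X -> real_lsc g -> g x = 0 -> contractive_form p -> 0 < tau ->
  (forall e : R, 0 < e -> exists2 r : R, 0 < r & forall u, `|u - x| < r ->
    p (u - x) <= tau * Num.max (g u) 0 + e * `|u - x|) ->
  forall e : R, 0 < e -> exists u (a : R) (w l : X -> R),
    [/\ `|u - x| < e /\ `|g u| < e, 0 < a <= tau,
      linear_form l /\ (forall z, `|l z| <= e * `|z|),
      linear_form w /\ frechet_subgradient_on setT g u w &
      forall z, p z = a * w z - l z /\ `|w z| <= (1 + e) / a * `|z|].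
Proof.
move=> XA gl gx [lp p1] tau0 Hp e e0.
have [r1 r10 Hr1] := Hp (e / 8) (divr_gt0 e0 (ltr0n _ 8)).
have [r2 r20 Hr2] := gl x (- e) (ltac:(by rewrite gx oppr_lt0)).
pose r := Num.min (Num.min (r1 / 2) (r2 / 2)) (Num.min e (tau * e / 4)).
have r0 : 0 < r by rewrite !lt_min !divr_gt0 ?e0// mulr_gt0.
have rr1 : r <= r1 / 2 by rewrite !ge_min lexx.
have rr2 : r <= r2 / 2 by rewrite !ge_min lexx !orbT.
have re : r <= e by rewrite !ge_min lexx !orbT.
have rte : r <= tau * e / 4 by rewrite !ge_min lexx !orbT.
(* The second bound gives [h x <= e * r / 16], which with the error [e * r / 8] on the ball stays
   below [e * r / 4]; the first helps to keep [g u] below [e]. *)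
pose k := Num.min (e / 2) (e * r / (8 * tau)).
have k0 : 0 < k by rewrite lt_min !divr_gt0// !mulr_gt0.
have ke : k <= e / 2 by rewrite ge_min lexx.
have kt : tau * k <= e * r / 8.
  have : k <= e * r / (8 * tau) by rewrite ge_min lexx orbT.
  rewrite -(ler_pM2l tau0); suff -> : tau * (e * r / (8 * tau)) = e * r / 8 by [].
  by field; rewrite gt_eqF.
have [phi [phi0 phi_ge phi_mono phi_diff]] := smooth_positive_part k k0.
pose h u := tau * phi (g u) + p (x - u).
have pB u : p (x - u) = - p (u - x) by rewrite -opprB linear_formN.
have hl : real_lsc h.
  apply: (@real_lscD R X _ (fun u => p (x - u)) 1) => // [|u v].
    apply: (real_lsc_comp g (fun t => tau * phi t) tau) => // t t' tt'.
    have /andP[h1 h2] := phi_mono t t' tt'.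
    by rewrite -mulrDr !ler_pM2l// h1.
  have -> : p (x - u) = p (x - v) + p (v - u) by rewrite -linear_formD// addrA subrK.
  by rewrite lerD2l mul1r distrC; exact: le_trans (ler_norm _) (p1 _).
have hx : h x = tau * k / 2 by rewrite /h gx phi0 subrr linear_form0//; lra.
have [z zr|u [l [ux hux ll le ls]]] := asplund_frechet_subgradient h x r e XA hl r0 e0.
  have := Hr1 z (ltac:(lra)); rewrite hx /h pB.
  have : tau * Num.max (g z) 0 <= tau * phi (g z).
    by rewrite ler_pM2l// ge_max; have [-> ->] := phi_ge (g z).
  have : e / 8 * `|z - x| <= e / 8 * r by rewrite ler_wpM2l// divr_ge0// ltW.
  have : 0 < e * r by rewrite mulr_gt0.
  by lra.
have gu_lb : - e < g u by apply: Hr2; lra.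
have gu_ub : g u < e.
  have h1 : tau * phi (g u) <= tau * k / 2 + r.
    move: hux; rewrite hx /h pB; have := le_trans (ler_norm _) (p1 (u - x)); lra.
  rewrite -(ltr_pM2l tau0); apply: (@le_lt_trans _ _ (tau * phi (g u))).
    by rewrite ler_pM2l//; exact: (phi_ge _).2.
  have : tau * k <= tau * (e / 2) by rewrite ler_pM2l.
  have : 0 < tau * e by rewrite mulr_gt0.
  by lra.
have [a [c [a0 a1 c0 Hac]]] := phi_diff (g u).
have ta0 : 0 < tau * a by rewrite mulr_gt0.
pose m z := p z + l z.
have lm : linear_form m by move=> b y z; rewrite /m lp ll; ring.
have m_le z : `|m z| <= (1 + e) * `|z|.
  by have := ler_normD (p z) (l z); have := p1 z; have := le z; rewrite /m; lra.
have hm : frechet_subgradient_on setT (fun u => tau * phi (g u)) u m.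
  move=> b b0; have [q q0 Hq] := ls b b0; exists q => // z _ zq.
  have := Hq z I zq; rewrite /h /m.
  have -> : p (x - (u + z)) = p (x - u) - p z by rewrite -linear_formB// opprD addrA.
  by lra.
exists u, (tau * a), (fun z => (tau * a)^-1 * m z), l; split => //.
- by split; [lra|rewrite ltr_norml gu_lb].
- by rewrite ta0 ler_piMr// ltW.
- split; first by move=> b y z; rewrite lm; ring.
  apply: (subgradient_chain g (fun u => tau * phi (g u)) u m (tau * a) (tau * c) (1 + e)) => //.
  + by rewrite mulr_ge0// ltW.
  + by rewrite addr_ge0// ltW.
  + move=> z; rewrite -!mulrA -!mulrDr ler_pM2l//.
    have := Hac (g (u + z) - g u); rewrite [g u + _]addrC subrK.
    by [].
- move=> z; split; first by rewrite mulVKf ?gt_eqF// /m; ring.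
  rewrite normrM gtr0_norm ?invr_gt0// [(1 + e) / _]mulrC -mulrA.
  by rewrite ler_pM2l ?invr_gt0.
Qed.

End subgradients.

(** * Replacing an extended-valued function by a finite one *)

Section truncation.
Context {R : realType} {X : completeNormedModType R}.
Implicit Types (f : X -> \bar R) (a : R).

(** Capping at [a + 1] makes the function finite and keeps it lower semicontinuous; where
    [f u < a + 1] it is [f u - a]. *)
Definition truncated_gap f a (u : X) : R := fine (mine (f u) (a + 1)%:E) - a.

Lemma truncated_gap_cases f a u : (-oo < f u)%E ->
  (exists b, [/\ f u = b%:E, b < a + 1 & truncated_gap f a u = b - a]) \/
  ((a + 1)%:E <= f u)%E /\ truncated_gap f a u = 1.
Proof.
rewrite /truncated_gap; case: (f u) => [b _|_|//].
  have [ba|ba] := ltP b (a + 1); [left; exists b; split|right; split] => //.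
  - by rewrite min_l// lee_fin ltW.
  - by rewrite min_r ?lee_fin//=; lra.
by right; split; [exact: leey|rewrite min_r ?leey//=; lra].
Qed.

Lemma truncated_gap_le f a u : (-oo < f u)%E -> ((truncated_gap f a u + a)%:E <= f u)%E.
Proof.
move=> /(truncated_gap_cases f a)[[b [-> _ ->]]|[h ->]]; first by rewrite subrK.
by rewrite addrC.
Qed.

Lemma truncated_gap_lsc f a : (forall u, (-oo < f u)%E) -> lower_semicontinuous f ->
  real_lsc (truncated_gap f a).
Proof.
move=> fy fl x b bx.
have bfx : ((b + a)%:E < f x)%E.
  by apply: lt_le_trans (truncated_gap_le f a x (fy x)); rewrite lte_fin ltrD2r.
have [V /nbhs_ballP[r /= r0 Hr] HV] := fl x _ bfx.
exists r => // y yr; have /HV by_lt : V y by apply: Hr; rewrite -ball_normE/= distrC.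
have b1 : b < 1.
  by move: bx; case: (truncated_gap_cases f a x (fy x)) => [[c [_ h ->]]|[_ ->]]; lra.
case: (truncated_gap_cases f a y (fy y)) => [[c [fyE _ ->]]|[_ ->]//].
by move: by_lt; rewrite fyE lte_fin; lra.
Qed.

End truncation.


Section frechet_subdifferentials.
Context {R : realType} {X : completeNormedModType R}.
Implicit Types (f : X -> \bar R) (u : X) (w : X -> R^o).

Lemma dual_pair_cont_dual w (c al : R) : linear_form w -> 0 < c ->
  (forall z, `|w z| <= c * `|z|) -> cont_dual (dual_pair w al).
Proof.
move=> lw c0 wc; have ca : 0 < c + `|al| by rewrite ltr_pwDl.
apply: (bounded_form_cont_dual _ _ _ ca).
  move=> b [y s] [z t]; rewrite /dual_pair/= lw.
  change (b * w y + w z + al * (b * s + t) =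
    b * (w y + al * s) + (w z + al * t) :> R).
  by ring.
move=> z; rewrite /dual_pair mulrDl; apply: le_trans (ler_normD _ _) _.
have h1 : `|z.1| <= `|z| by rewrite prod_normE le_max lexx.
have h2 : `|z.2| <= `|z| by rewrite prod_normE le_max lexx orbT.
apply: lerD; first by apply: le_trans (wc _) _; rewrite ler_pM2l.
by rewrite normrM ler_wpM2l.
Qed.

(** The capped function plus [a] lies below [f] and agrees with it at [u], so its lower estimates
    hold on the epigraph of [f]; the maximum norm on the product dominates [|y - u|]. *)
Lemma truncated_subgradient_frechet_subdiff f (a b c : R) u w :
  (forall x, (-oo < f x)%E) -> f u = b%:E -> b < a + 1 ->
  linear_form w -> 0 < c -> (forall z, `|w z| <= c * `|z|) ->
  frechet_subgradient_on setT (truncated_gap f a) u w -> frechet_subdiff f u w.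
Proof.
move=> fy fu ba lw c0 wc Hw; split; first by rewrite fu ltry.
split; first exact: bounded_form_cont_dual c0 wc.
apply/frechet_normal_coneP; first exact: dual_pair_cont_dual c0 wc.
move=> e e0; have [r r0 Hr] := Hw e e0; exists r => // -[y t] /= fyt yr.
rewrite /dual_pair/= fu/= in yr *.
have h1 : `|y - u| <= `|(y, t) - (u, b)| by rewrite prod_normE le_max lexx.
have := Hr (y - u) I (le_lt_trans h1 yr); rewrite [u + _]addrC subrK.
have -> : truncated_gap f a u = b - a.
  by rewrite /truncated_gap fu min_l//= lee_fin ltW.
have := le_trans (truncated_gap_le f a y (fy y)) fyt; rewrite lee_fin/= => h2 h3.
have : e * `|y - u| <= e * `|(y, t) - (u, b)| by rewrite ler_pM2l.
move: h2 h3; move: (w _) (e * _) (e * _) (truncated_gap _ _ _) => v c1 c2 s h2 h3.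
by change (c2 <= c1 -> (v : R) + -1 * ((t : R) - b) <= c1); lra.
Qed.

Lemma frechet_singular_subdiff0 f u : (f u < +oo)%E -> frechet_singular_subdiff f u 0.
Proof.
move=> fu; have l0 : linear_form (0 : X -> R^o) 
  by move=> b y z; change ((0 : R) = b * 0 + 0); rewrite mulr0 addr0.
have b0 z : `|(0 : X -> R^o) z| <= 1 * `|z| by change (`|0 : R| <= 1 * `|z|); rewrite normr0 mul1r.
split => //; split; first exact: bounded_form_cont_dual b0.
apply/frechet_normal_coneP; first exact: dual_pair_cont_dual b0.
move=> e e0; exists 1 => // z _ _.
rewrite /dual_pair mul0r addr0; change ((0 : R) <= e * `|z - (u, fine (f u))|).
by rewrite mulr_ge0// ltW.
Qed.

End frechet_subdifferentials.

Theorem theorem3p2 (R : realType) (X : completeNormedModType R)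
    (f : X -> \bar R) (xbar : X) :
  asplund_space X ->
  proper_fun f ->
  lower_semicontinuous f ->
  sublevel0 f xbar ->
  local_error_bound f xbar ->
  exists tau delta0 : R, [/\ 0 < tau, 0 < delta0 &
    forall eps : R, 0 < eps ->
    forall x : X, (sublevel0 f `&` ball xbar delta0) x ->
      frechet_normal_cone (sublevel0 f) x `&` dual_unit_ball X `<=`
      set_add
        (\bigcup_(uv in fball f x eps `*` fball f x eps)
           set_add
             (set_scale `[0, (1 + eps) * tau] (frechet_subdiff f uv.1))
             (frechet_singular_subdiff f uv.2))
        (set_scale [set eps] (dual_unit_ball X))].
Proof.
move=> XA [fy _] fl fxbar [tau [delta [tau0 delta0 feb]]].
exists tau, delta; split => // eps eps0 x [fx0 xb] p [pN /dual_unit_ballE Cp].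
have pcd := pN.1; move/(frechet_normal_coneP _ _ _ pcd) : pN => pN.
have [a fxa] : exists a, f x = a%:E.
  by have := fy x; move: fx0; rewrite /sublevel0/=; case: (f x) => // a _ _; exists a.
have a0 : a <= 0 by move: fx0; rewrite /sublevel0/= fxa lee_fin.
pose g := truncated_gap f a.
have gx : g x = 0 by rewrite /g /truncated_gap fxa min_l ?lee_fin/=; lra.
have gl : real_lsc g by exact: truncated_gap_lsc.
have [r1 /= r10 Hr1] : exists2 r : R, 0 < r & forall u, `|u - x| < r -> ball xbar delta u.
  move: xb; rewrite -ball_normE/= => xb.
  exists (delta - `|xbar - x|) => [|u ux]; first by rewrite subr_gt0.
  by have := ler_distD x xbar u; rewrite (distrC x u); lra.
have Hp (e : R) : 0 < e -> exists2 r : R, 0 < r & forall u, `|u - x| < r ->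
    p (u - x) <= tau * Num.max (g u) 0 + e * `|u - x|.
  move=> e0; have [r2 r20 Hr2] := normal_le_dist _ x p Cp fx0 pN e e0.
  (* The radius [tau] serves the capped points: there [g u = 1] and [p (u - x) <= |u - x| < tau]. At
     the others [a <= 0] bounds the positive part of [f] by that of [g]. *)
  exists (Num.min (Num.min r1 r2) tau) => [|u]; first by rewrite !lt_min r10 r20.
  rewrite !lt_min => /andP[/andP[ur1 ur2] utau].
  have := feb u (Hr1 u ur1); rewrite /g.
  have [[b [fub ba ->]]|[_ ->] _] := truncated_gap_cases f a u (fy u).
    rewrite fub -EFin_max -EFinM => /(Hr2 u _ ur2) /le_trans; apply.
    rewrite lerD2r ler_pM2l// ge_max !le_max lexx orbT andbT.
    by apply/orP; left; lra.
  rewrite max_l// mulr1; apply: le_trans (ler_norm _) _.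
  apply: le_trans (Cp.2 _) _; apply: (le_trans (ltW utau)).
  by rewrite lerDl mulr_ge0// ltW.
(* With [e <= 1], [|g u| < e] rules out the capped value 1, so [f u] is finite. *)
pose e := Num.min eps 1.
have e0 : 0 < e by rewrite lt_min eps0 ltr01.
have e_eps : e <= eps by rewrite ge_min lexx.
have e_1 : e <= 1 by rewrite ge_min lexx orbT.
have [u [lam [w [l [[ux gu] /andP[lam0 lamtau] [ll le] [lw ws] pE]]]]] :=
  asplund_positive_part_subgradient g x p tau XA gl gx Cp tau0 Hp e e0.
have [b [fub ba gub]] : exists b, [/\ f u = b%:E, b < a + 1 & g u = b - a].
  have [//|[_ g1]] := truncated_gap_cases f a u (fy u).
  by move: gu; rewrite /g g1 normr1; lra.
have ub : fball f x eps u.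
  split; first by rewrite -ball_normE/= distrC; exact: lt_le_trans ux e_eps.
  by rewrite fub fxa -EFinB abse_EFin lte_fin -gub; exact: lt_le_trans gu e_eps.
have c0 : 0 < (1 + e) / lam by rewrite divr_gt0// addr_gt0.
exists (lam *: (w : X -> R^o) + 0).
  exists (u, u) => //=; exists (lam *: (w : X -> R^o)).
    exists lam => /=.
      rewrite in_itv/= (ltW lam0)/=; apply: le_trans lamtau _.
      by rewrite ler_peMl ?(ltW tau0)// lerDl ltW.
    exists (w : X -> R^o) => //.
    by apply: truncated_subgradient_frechet_subdiff fub ba lw c0 _ ws => // z; exact: (pE z).2.
  by exists 0 => //; apply: frechet_singular_subdiff0; rewrite fub ltry.
exists (- (l : X -> R^o)).
  exists eps => //=; exists (- eps^-1 *: (l : X -> R^o)).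
    apply: contractive_dual_unit_ball; split.
      by move=> c y z; rewrite !fctE ll /=; rewrite /GRing.scale/=; ring.
    have ie : `|eps^-1| = eps^-1 by rewrite gtr0_norm// invr_gt0.
    move=> z; rewrite fctE normrM normrN ie ler_pdivrMl//.
    by apply: le_trans (le z) _; rewrite ler_wpM2r.
  by rewrite scalerA mulrN divff ?gt_eqF// scaleN1r.
by apply/funext => z; rewrite !fctE (pE z).1 addr0.
Qed.
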